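(* Let $\alpha\in(0,1)$, let $f$ be a $(\delta,L,K,\epsilon)$-regular function satisfying the alternative hypothesis $H_1$: $f$ is $(\Xi,\epsilon)$-periodic with constant $K$, for some $\Xi>0$. Assume the condition $a\ge4c_\alpha$ (for all sufficiently large $n$), and $b=b_n\to\infty$, $b=o(n/\log n)$. Then the test $\phi$ has type II error asymptotically bounded by $\alpha$: under $H_1$, $$\limsup_{n\to\infty}P(\phi(X_m)=0)\le\alpha .$$
   Context: $\mathbb{T}=[T_{\min},T_{\max}]$ is a compact interval; $T=\{t_1,\dots,t_n\}$ with $t_i$ i.i.d. uniform on $\mathbb{T}$; $SW_{m,\tau}f(t)=(f(t),f(t+\tau),\dots,f(t+m\tau))\in\mathbb{R}^{m+1}$ with $m,\tau$ fixed; $X_m=X_{m,\tau}=SW_{m,\tau}f(T)$, $M_{m,\tau}=SW_{m,\tau}f(\mathbb{T})$. Let $L_{m,\tau}(t)=\binom{n}{b}^{-1}\sum_{j} I(d_H(X_{m,\tau},X_{m,\tau,b}^{(j)})>t)$, the sum over all $\binom nb$ subsamples of $X_{m,\tau}$ of size $b$, $d_H$ the Hausdorff distance, and $c_\alpha=2(L_{m,\tau})^{-1}(\alpha)$ with $(L_{m,\tau})^{-1}(\alpha)=\inf\{t\ge0:L_{m,\tau}(t)\le\alpha\}$. $\mathcal{P}(A)$ is the $1$-dimensional persistence diagram (off-diagonal points (birth, death), field coefficients) of the sublevel-set filtration of the distance function to $A$. The rejection region is $R=\{(x,y)\in\mathcal{P}(X_m): x<c_\alpha\text{ and }y-x\ge2c_\alpha\}$,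 and $\phi(X_m)=1$ (reject $H_0$) if $|\mathcal{P}(X_m)\cap R|\ge1$, $\phi(X_m)=0$ (accept $H_0$) if $|\mathcal{P}(X_m)\cap R|=0$. The null hypothesis $H_0$ is that $f$ is $\epsilon$-non-periodic, i.e. (for some $K>0$) $|t_1-t_2|\ge K\epsilon$ implies $|f(t_1)-f(t_2)|\ge\epsilon$ or $|f'(t_1)-f'(t_2)|\ge\epsilon$. A differentiable $f:\mathbb{R}\to\mathbb{R}$ with bounded derivative is $(\Xi,\epsilon)$-periodic with constant $K>0$ if $f(t+\Xi)=f(t)$ for all $t\in\mathbb{R}$, and for all $t_1,t_2\in\mathbb{R}$ with $\min_{n\in\mathbb{Z}}|t_1-t_2+n\Xi|\ge K\epsilon$ one has $|f(t_1)-f(t_2)|\ge\epsilon$ or $|f'(t_1)-f'(t_2)|\ge\epsilon$. A function $f:\mathbb{R}\to\mathbb{R}$ is $(\delta,L,K,\epsilon)$-regular if: $f\in C^2$; for all $t\in\mathbb{R}$, $|f'(t)|\ge\delta$ or $|f''(t)|\ge\delta$; for all $t\in\mathbb{R}$, $|f'(t)|\le L$ and $|f''(t)|\le L$; and for all $t_1,t_2\in\mathbb{R}$ with $|t_1-t_2|\le K\epsilon$, $|f(t_1)-f(t_2)|\ge\delta|t_1-t_2|$ or $|f'(t_1)-f'(t_2)|\ge\delta|t_1-t_2|$. $a=\frac{\sqrt{m+1}}{2}\min\{\epsilon,C_{\delta,L}\}$, where $C_{\delta,L}>0$ is a constant depending only on $\delta,L$ such that for every $(\delta,L,K,\epsilon)$-regular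 function $f$ that is $(\Xi,\epsilon)$-periodic with constant $K$ for some $\Xi>0$ (and $\tau$ small enough) $\mathcal{P}(M_{m,\tau})\cap([0,a)\times\mathbb{R})=\{(0,d)\}$ with $d\ge a$. *)

(* Defs.v *)
From HB Require Import structures.
From mathcomp Require Import all_boot all_order all_algebra.
From mathcomp Require Import all_classical all_reals all_analysis.
Set Implicit Arguments.
Unset Strict Implicit.
Unset Printing Implicit Defensive.
Import Order.TTheory GRing.Theory Num.Theory.
Import numFieldNormedType.Exports.
Local Open Scope classical_set_scope.
Local Open Scope ring_scope.

Section Metric.
Variables (R : realType) (N : nat).
Implicit Types (x : 'rV[R]_N) (A B : set 'rV[R]_N).

(* The library norm on ['rV[R]_N] is the sup norm, which induces the same
   topology but not the same distances. *)
Definition enorm x : R := Num.sqrt (\sum_(j < N) x 0 j ^+ 2).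

(* [inf] and [sup] are real-valued (0 on the empty set): the next three
   definitions are meant for nonempty bounded sets. *)
Definition dist_to A x : R := inf [set enorm (x - y) | y in A].

Definition hausdorff A B : R :=
  Num.max (sup [set dist_to B x | x in A]) (sup [set dist_to A y | y in B]).

Definition dist_sublevel A (r : R) : set 'rV[R]_N :=
  [set x | dist_to A x <= r].

End Metric.

Section SingularHomology.
Variables (R : realType) (F : fieldType) (N : nat).

Definition std_simplex (k : nat) : set 'rV[R]_k.+1 :=
  [set x | (forall j, 0 <= x 0 j) /\ \sum_j x 0 j = 1].

Definition simplex_map (k : nat) : Type := 'rV[R]_k.+1 -> 'rV[R]_N.

(* A map on the standard simplex is represented by its extension by 0, so that
   equal maps are equal as Rocq functions.  A face inclusion sends exactly the
   points of the smaller simplex into the larger one, so precomposing with it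
   preserves this normalization. *)
Definition singular_simplex (A : set 'rV[R]_N) (k : nat) :
    set (simplex_map k) :=
  [set s | [/\ {within std_simplex (k:=k), continuous s},
               (forall x, std_simplex x -> A (s x)) &
               (forall x, ~ std_simplex x -> s x = 0)]].

Definition face_inclusion (k : nat) (i : 'I_k.+2) (x : 'rV[R]_k.+1) :
    'rV[R]_k.+2 :=
  \row_j (if unlift i j is Some j' then x 0 j' else 0).

Definition chain (k : nat) : Type := simplex_map k -> F.

Definition chain_in (A : set 'rV[R]_N) (k : nat) : set (chain k) :=
  [set c | finite_set [set s | c s != 0] /\
           (forall s, c s != 0 -> singular_simplex A s)].

Definition boundary (k : nat) (c : chain k.+1) : chain k := fun t =>
  \sum_(s \in [set: simplex_map k.+1])
    c s * \sum_(i < k.+2) (-1) ^+ i * (s \o @face_inclusion k i == t)%:R.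

Definition cycles1 (A : set 'rV[R]_N) : set (chain 1) :=
  [set c | chain_in A c /\ boundary c = fun=> 0].

Definition boundaries1 (A : set 'rV[R]_N) : set (chain 1) :=
  [set c | exists2 e : chain 2, chain_in A e & boundary e = c].

(* Rank, possibly infinite, of the map H_1(A; F) -> H_1(B; F) induced by an
   inclusion of A in B. *)
Definition H1_rank (A B : set 'rV[R]_N) : \bar R :=
  ereal_sup [set n%:R%:E | n in [set n : nat |
    exists z : 'I_n -> chain 1,
      (forall i, cycles1 A (z i)) /\
      (forall a : 'I_n -> F,
         boundaries1 B (fun s => \sum_i a i * z i s) -> forall i, a i = 0)]].

End SingularHomology.

Section Persistence.
Variables (R : realType) (F : fieldType) (N : nat).
Local Open Scope ereal_scope.

Definition H1_persistent_rank (A : set 'rV[R]_N) (s t : R) : \bar R :=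
  H1_rank F (dist_sublevel A s) (dist_sublevel A t).

(* Number of classes born in ]p, q] and dying in ]r, s], for p < q < r < s.
   For compact A all ranks involved are finite. *)
Definition rectangle_measure (A : set 'rV[R]_N) (p q r s : R) : \bar R :=
  (H1_persistent_rank A q r - H1_persistent_rank A p r) -
  (H1_persistent_rank A q s - H1_persistent_rank A p s).

(* The multiplicity of a point of the diagram of a q-tame persistence module
   is the least measure of a rectangle containing it in its interior (Chazal,
   de Silva, Glisse, Oudot).  Rectangles may reach p < 0, where the sublevel
   set is empty, so that points with birth 0 are counted.  For A nonempty and
   bounded, large sublevel sets have trivial H_1, so no death is infinite. *)
Definition dgm_mult (A : set 'rV[R]_N) (x y : R) : \bar R :=
  ereal_inf [set mu | exists p q r s : R,
    [/\ (p < x < q)%R, (q < r)%R, (r < y < s)%R &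
        mu = rectangle_measure A p q r s]].

(* Off-diagonal points of the 1-dimensional diagram, without multiplicity. *)
Definition dgm (A : set 'rV[R]_N) : set (R * R) :=
  [set z | (z.1 < z.2)%R /\ 0 < dgm_mult A z.1 z.2].

End Persistence.

Section Signals.
Variable R : realType.
Implicit Types (f : R -> R) (m : nat) (tau delta L K eps Xi : R).

Definition SW f m tau (t : R) : 'rV[R]_m.+1 :=
  \row_(j < m.+1) f (t + j%:R * tau).
Arguments SW f m tau t : clear implicits.

Definition eps_periodic Xi eps K f : Prop :=
  [/\ forall t, derivable f t 1,
      exists B, forall t, `|derive1 f t| <= B,
      forall t, f (t + Xi) = f t &
      forall t1 t2, (forall n : int, K * eps <= `|t1 - t2 + n%:~R * Xi|) ->
        eps <= `|f t1 - f t2| \/ eps <= `|derive1 f t1 - derive1 f t2|].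

Definition regular delta L K eps f : Prop :=
  [/\ [/\ forall t, derivable f t 1,
          forall t, derivable (derive1 f) t 1 &
          continuous (derive1n 2 f)],
      forall t, delta <= `|derive1 f t| \/ delta <= `|derive1n 2 f t|,
      forall t, `|derive1 f t| <= L /\ `|derive1n 2 f t| <= L &
      forall t1 t2, `|t1 - t2| <= K * eps ->
        delta * `|t1 - t2| <= `|f t1 - f t2| \/
        delta * `|t1 - t2| <= `|derive1 f t1 - derive1 f t2|].

Definition SW_curve f m tau (Tmin Tmax : R) : set 'rV[R]_m.+1 :=
  SW f m tau @` `[Tmin, Tmax].
Arguments SW_curve f m tau Tmin Tmax : clear implicits.

Definition feature_size m eps (C : R) : R :=
  Num.sqrt m.+1%:R / 2 * Num.min eps C.

(* [C] does not depend on [K], [eps], [Xi] or [f]; [tau0 K eps f] is the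
   threshold below which [tau] counts as small enough for [f].  The delay is
   fixed: as it tends to 0 the curve collapses onto the diagonal, and no
   positive [C] would serve for all smaller delays at once. *)
Definition feature_constant (F : fieldType) m tau (Tmin Tmax : R)
    (tau0 : R -> R -> (R -> R) -> R) delta L (C : R) : Prop :=
  0 < C /\
  forall K eps Xi f, 0 < K -> 0 < eps -> 0 < Xi ->
    regular delta L K eps f -> eps_periodic Xi eps K f ->
    0 < tau < tau0 K eps f ->
    exists2 d : R, feature_size m eps C <= d &
      dgm F (SW_curve f m tau Tmin Tmax) `&`
        [set z | 0 <= z.1 < feature_size m eps C] = [set (0, d)].

End Signals.
Arguments SW {R} f m tau t.
Arguments SW_curve {R} f m tau Tmin Tmax.

Section Test.
Variables (R : realType) (f : R -> R) (m : nat) (tau : R) (n : nat).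
Implicit Types (ts : 'I_n -> R) (J : {set 'I_n}) (b : nat) (alpha : R).

Definition SW_sample ts : set 'rV[R]_m.+1 := range (SW f m tau \o ts).

Definition SW_subsample ts J : set 'rV[R]_m.+1 :=
  [set SW f m tau (ts i) | i in [set` J]].

Definition subsampling_tail b ts (r : R) : R :=
  'C(n, b)%:R^-1 *
  \sum_(J : {set 'I_n} | #|J| == b)
    (r < hausdorff (SW_sample ts) (SW_subsample ts J))%R%:R.

Definition critical_value b alpha ts : R :=
  2 * inf [set r | 0 <= r /\ subsampling_tail b ts r <= alpha].

Definition rejection_region (F : fieldType) b alpha ts : set (R * R) :=
  let c := critical_value b alpha ts in
  [set z | [/\ dgm F (SW_sample ts) z, z.1 < c & 2 * c <= z.2 - z.1]].

Definition phi (F : fieldType) b alpha ts : nat :=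
  `[< dgm F (SW_sample ts) `&` rejection_region F b alpha ts !=set0 >].

End Test.

Section Sampling.
Context (d : measure_display) (Omega : measurableType d) (R : realType).
Variable P : probability Omega R.

Definition mutually_independent (t : nat -> {RV P >-> R}) : Prop :=
  forall (s : seq nat) (A : nat -> set R), uniq s ->
    (forall i, measurable (A i)) ->
    P (\big[setI/setT]_(i <- s) (t i @^-1` A i)) =
    (\prod_(i <- s) P (t i @^-1` A i))%E.

Definition iid_uniform (Tmin Tmax : R) (hT : Tmin < Tmax)
    (t : nat -> {RV P >-> R}) : Prop :=
  mutually_independent t /\
  forall i (A : set R), measurable A ->
    distribution P (t i) A = uniform_prob hT A.

End Sampling.

(* Main.v *)
Require Import Defs.
From HB Require Import structures.
From mathcomp Require Import all_boot all_order all_algebra.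
From mathcomp Require Import all_classical all_reals all_analysis.
From mathcomp Require Import measurable_realfun.
From mathcomp Require Import ring lra zify.
Set Implicit Arguments.
Unset Strict Implicit.
Unset Printing Implicit Defensive.
Import Order.TTheory GRing.Theory Num.Theory.
Import numFieldNormedType.Exports.
Local Open Scope classical_set_scope.
Local Open Scope ring_scope.

(* The curve M = SW f([Tmin, Tmax]) has positive extent in its first coordinate
   (f is not constant, by regularity), so deterministically no b of its points
   are closer to M than l/(2b) in the Hausdorff distance, l being an increment
   of f.  The n sample points, on the contrary, are closer to M than l/(8b) with
   probability tending to 1, because b = o(n / log n): cut [Tmin, Tmax] into a
   multiple of b cells and bound the probability that one of them is missed.
   Hence c_alpha > d_H(X, M) with probability tending to 1.  With a fixed number
   of cells instead, and Markov's inequality for the proportion of subsamples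
   that miss a cell, 4 c_alpha <= a with probability tending to 1.

   When both hold the test rejects, by stability.  The diagram point (0, d) gives
   a 1-cycle in a small thickening of M that bounds only in thickenings by about
   d or more; X and M being d_H-close, the same chain is such a cycle for X, and
   bisecting rectangles locates a point of the diagram of X.  This uses that the
   persistent ranks of X are finite: a path in a thickening is homologous, in a
   larger one, to a polygonal path through a finite grid, up to terms that depend
   only on its end points and cancel in a cycle.

   So the type II error even tends to 0. *)

(** * Relative ranks *)

Section RelativeRank.
Variables (F : fieldType) (T : Type).
Implicit Types (B Z : set (T -> F)).

(** Homology is handled without quotients: independence and span below are taken modulo a subspace
    [B], later a space of boundaries. *)
Definition lin_subspace B : Prop :=
  B (fun=> 0) /\
  forall a u v, B u -> B v -> B (fun s => a * u s + v s).

Definition lincomb (I : finType) (a : I -> F) (z : I -> T -> F) : T -> F :=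
  fun s => \sum_i a i * z i s.

Definition indep B (I : finType) (z : I -> T -> F) : Prop :=
  forall a, B (lincomb a z) -> forall i, a i = 0.

Definition in_span B (I : finType) (e : I -> T -> F) (u : T -> F) : Prop :=
  exists a, B (u \- lincomb a e).

Lemma subspaceD B u v : lin_subspace B -> B u -> B v -> B (u \+ v).
Proof.
move=> [_ hB] hu hv; have := hB 1 _ _ hu hv.
by congr B; apply/funext => s /=; rewrite mul1r.
Qed.

Lemma subspaceZ B a u : lin_subspace B -> B u -> B (fun s => a * u s).
Proof.
move=> [hB0 hB] hu; have := hB a _ _ hu hB0.
by congr B; apply/funext => s /=; rewrite addr0.
Qed.

Lemma subspaceN B u : lin_subspace B -> B u -> B (\- u).
Proof.
move=> sB hu; have := subspaceZ (-1) sB hu.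
by congr B; apply/funext => s /=; rewrite mulN1r.
Qed.

Lemma subspaceB B u v : lin_subspace B -> B u -> B v -> B (u \- v).
Proof. by move=> sB hu hv; apply: subspaceD => //; apply: subspaceN. Qed.

Lemma subspace_sum B (I : Type) (r : seq I) (P : pred I) (u : I -> T -> F) :
  lin_subspace B -> (forall i, P i -> B (u i)) ->
  B (fun s => \sum_(i <- r | P i) u i s).
Proof.
move=> sB hu; elim: r => [|i r IH].
  by have [h0 _] := sB; move: h0; congr B; apply/funext => s; rewrite big_nil.
case: (boolP (P i)) => hi; last first.
  by move: IH; congr B; apply/funext => s; rewrite big_cons (negbTE hi).
have := subspaceD sB (hu _ hi) IH.
by congr B; apply/funext => s; rewrite big_cons hi.
Qed.

Lemma subspace_lincomb B (I : finType) (a : I -> F) (z : I -> T -> F) :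
  lin_subspace B -> (forall i, B (z i)) -> B (lincomb a z).
Proof.
by move=> sB hz; apply: subspace_sum => // i _; apply: subspaceZ.
Qed.

Lemma in_spanD B (I : finType) (e : I -> T -> F) u v :
  lin_subspace B -> in_span B e u -> in_span B e v -> in_span B e (u \+ v).
Proof.
move=> sB [a ha] [c hc]; exists (fun i => a i + c i).
have := subspaceD sB ha hc; congr B; apply/funext => s /=.
rewrite /lincomb -addrACA -opprD -big_split /=; congr (_ - _).
by apply: eq_bigr => i _; rewrite mulrDl.
Qed.

Lemma in_spanZ B (I : finType) (e : I -> T -> F) u c :
  lin_subspace B -> in_span B e u -> in_span B e (fun s => c * u s).
Proof.
move=> sB [a ha]; exists (fun i => c * a i).
have := subspaceZ c sB ha; congr B; apply/funext => s /=.
rewrite /lincomb mulrBr mulr_sumr; congr (_ - _).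
by apply: eq_bigr => i _; rewrite mulrA.
Qed.

Lemma in_spanN B (I : finType) (e : I -> T -> F) u :
  lin_subspace B -> in_span B e u -> in_span B e (\- u).
Proof.
move=> sB /(in_spanZ (-1) sB); congr in_span.
by apply/funext => s; rewrite mulN1r.
Qed.

Lemma in_spanW B (I : finType) (e : I -> T -> F) u :
  lin_subspace B -> B u -> in_span B e u.
Proof.
move=> sB hu; exists (fun=> 0); move: hu; congr B; apply/funext => s.
by rewrite /lincomb /= big1 ?subr0 // => i _; rewrite mul0r.
Qed.

Lemma in_span_self B (I : finType) (e : I -> T -> F) i :
  lin_subspace B -> in_span B e (e i).
Proof.
move=> [sB _]; exists (fun j => (j == i)%:R); move: sB; congr B.
apply/funext => s; rewrite /lincomb /= (bigD1 i) //= eqxx mul1r big1 ?addr0.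
  by rewrite subrr.
by move=> j /negbTE ->; rewrite mul0r.
Qed.

Lemma in_span_sum B (I : finType) (e : I -> T -> F) (J : Type) (r : seq J)
    (u : J -> T -> F) :
  lin_subspace B -> (forall j, in_span B e (u j)) ->
  in_span B e (fun s => \sum_(j <- r) u j s).
Proof.
move=> sB hu; elim: r => [|j r IH].
  apply: in_spanW => //; have [h0 _] := sB; move: h0; congr B.
  by apply/funext => s; rewrite big_nil.
move: (in_spanD sB (hu j) IH); congr in_span.
by apply/funext => s; rewrite big_cons.
Qed.

(** The coefficients of [u] over [e] modulo [B] form a matrix. With more rows than columns, a
    nonzero vector of its left kernel would give a nontrivial combination of [u] in [B]. *)
Lemma steinitz B (I J : finType) (u : I -> T -> F) (e : J -> T -> F) :
  lin_subspace B -> (forall i, in_span B e (u i)) -> indep B u -> (#|I| <= #|J|)%N.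
Proof.
move=> sB he hu; rewrite leqNgt; apply/negP => hlt.
have [a ha] := choice he.
pose M : 'M[F]_(#|I|, #|J|) := \matrix_(i, j) a (enum_val i) (enum_val j).
have : kermx M != 0.
  rewrite -mxrank_eq0 mxrank_ker subn_eq0 -ltnNge.
  by apply: leq_ltn_trans (rank_leq_col M) _.
move=> /rowV0Pn[x /sub_kermxP xM x0].
have /hu h0 : B (lincomb (fun i => x 0 (enum_rank i)) u).
  have := subspace_lincomb (fun i => x 0 (enum_rank i)) sB ha.
  congr B; apply/funext => s; rewrite /lincomb.
  under eq_bigr do rewrite mulrBr; rewrite sumrB.
  rewrite [X in _ - X](_ : _ = 0) ?subr0 //.
  under eq_bigr do rewrite mulr_sumr.
  rewrite exchange_big big1 //= => j _.
  under eq_bigr do rewrite mulrA.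
  rewrite -mulr_suml [X in X * _](_ : _ = (x *m M) 0 (enum_rank j)).
    by rewrite xM mxE mul0r.
  rewrite mxE (reindex (@enum_val I (mem I))) /=; last first.
    by apply: onW_bij; apply: enum_val_bij.
  by apply: eq_bigr => i _; rewrite mxE enum_valK enum_rankK.
case/eqP: x0; apply/rowP => i; rewrite mxE.
by have := h0 (enum_val i); rewrite enum_valK.
Qed.

Definition extend (I J : finType) (z : I -> T -> F) (y : J -> T -> F)
  (k : I + J) : T -> F := match k with inl i => z i | inr j => y j end.

Lemma lincomb_extend (I J : finType) (z : I -> T -> F) (y : J -> T -> F) a :
  lincomb a (extend z y) =
  lincomb (a \o inl) z \+ lincomb (a \o inr) y.
Proof. by apply/funext => s; rewrite /lincomb big_sumType. Qed.

(** The span of [Z] has dimension at most [k] modulo [B], although both may be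
    infinite-dimensional. *)
Definition indep_bounded Z B k : Prop :=
  forall (I : finType) (z : I -> T -> F),
    (forall i, Z (z i)) -> indep B z -> (#|I| <= k)%N.

(** Elements of [Z] outside the span are added one by one; the bound [k] stops the process, by
    induction on [k - #|I|]. *)
Lemma indep_maximal Z B k (I : finType) (z : I -> T -> F) :
  lin_subspace B -> indep_bounded Z B k ->
  (forall i, Z (z i)) -> indep B z ->
  exists (J : finType) (y : J -> T -> F),
    [/\ forall j, Z (y j), indep B (extend z y) &
        forall u, Z u -> in_span B (extend z y) u].
Proof.
move=> sB hk.
have [p] := ubnP (k - #|I|)%N; elim: p I z => // p IH I z hp hz iz.
have [[u [hu hnu]]|hall] := pselect (exists u, Z u /\ ~ in_span B z u); last first.
  exists void, (of_void _); split=> //.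
  - move=> a; rewrite lincomb_extend => ha.
    have {}ha : B (lincomb (a \o inl) z).
      move: ha; congr B; apply/funext => s.
      by rewrite /= [X in _ + X]big1 ?addr0 //; case.
    by case=> [i|[]]; apply: (iz _ ha).
  - move=> u hu.
    have [[a ha]|nu] := pselect (in_span B z u); last by case: hall; exists u.
    exists (fun k => if k is inl i then a i else 0).
    move: ha; congr B; apply/funext => s; rewrite lincomb_extend /=.
    by rewrite [X in _ - (_ + X)]big1 ?addr0 //; case.
(* If the coefficient of [u] were nonzero, dividing by it would put [u] in the span of [z]. *)
have izu : indep B (extend z (fun _ : unit => u)).
  move=> a; rewrite lincomb_extend => ha.
  have a0 : a (inr tt) = 0.
    apply/eqP/negPn/negP => a0; apply: hnu.
    exists (fun i => - a (inl i) / a (inr tt)).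
    have := subspaceZ (a (inr tt))^-1 sB ha; congr B; apply/funext => s /=.
    rewrite mulrDr addrC /lincomb /=; congr (_ + _).
      by rewrite (big_pred1 tt) /= ?mulKf//; case.
    rewrite mulr_sumr -sumrN; apply: eq_bigr => i _.
    by rewrite mulNr mulNr opprK mulrCA mulrA.
  have {}ha : B (lincomb (a \o inl) z).
    move: ha; congr B; apply/funext => s /=.
    by rewrite [X in _ + X]big1 ?addr0 // => -[] _; rewrite /= a0 mul0r.
  by case=> [i|[]] //; apply: (iz _ ha).
have hzu : forall i, Z (extend z (fun _ : unit => u) i) by case.
have hI : (#|I| < k)%N.
  by have := hk _ _ hzu izu; rewrite card_sum card_unit addn1.
have [|J [y [hy iy sy]]] := IH _ _ _ hzu izu.
  by rewrite card_sum card_unit; move: hp hI; lia.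
(* Reassociates the index types [(I + unit) + J] and [I + (unit + J)]. *)
have e : forall a : I + (unit + J) -> F,
    lincomb a (extend z (extend (fun=> u) y)) =
    lincomb (fun k => match k with inl (inl i) => a (inl i)
      | inl (inr t) => a (inr (inl t)) | inr j => a (inr (inr j)) end)
      (extend (extend z (fun _ : unit => u)) y).
  by move=> a; apply/funext => s; rewrite /lincomb !big_sumType /= addrA.
exists (unit + J)%type, (extend (fun=> u) y); split.
- by case=> // j; apply: hy.
- move=> a; rewrite e => /iy h [i|[[]|j]].
  + exact: (h (inl (inl i))).
  + exact: (h (inl (inr tt))).
  + exact: (h (inr j)).
- move=> v /sy [a ha].
  exists (fun k => match k with inl i => a (inl (inl i))
    | inr (inl t) => a (inl (inr t)) | inr (inr j) => a (inr j) end).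
  move: ha; congr B; congr (_ \- _); rewrite e; congr lincomb.
  by apply/funext => -[[]|].
Qed.

Lemma indep_sub Z Z' B B' k : Z `<=` Z' -> B' `<=` B ->
  indep_bounded Z' B' k -> indep_bounded Z B k.
Proof.
move=> sZ sB hk I z hz iz; apply: (hk I z) => [i|a /sB].
  exact/sZ/hz.
exact: iz.
Qed.

Definition has_rank Z B k : Prop :=
  indep_bounded Z B k /\
  exists z : 'I_k -> T -> F, (forall i, Z (z i)) /\ indep B z.

Lemma indep_void B : indep B (of_void (T -> F)).
Proof. by move=> a _ []. Qed.

(* The relative rank [rk Z B] is [dim (Z + B) / B].  Writing [Z'], [B'] for the
   smaller cycle space and larger boundary space, both sides are counted by a
   basis [a] of [Z' / B'], completed by [c] in [Z / B'] and by [k] in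
   [(Z' `&` B') / B]; then [a], [c], [k], [w] are independent in [Z / B]. *)
Lemma rank_rectangle Z Z' B B' k k1 k2 k3 k4 w :
  lin_subspace B -> lin_subspace B' -> lin_subspace Z' ->
  Z' `<=` Z -> B `<=` B' -> indep_bounded Z B k ->
  Z w -> B' w -> (forall w', Z' w' -> ~ B (w \- w')) ->
  has_rank Z B k1 -> has_rank Z' B' k2 -> has_rank Z B' k3 ->
  has_rank Z' B k4 ->
  (k3 + k4 < k1 + k2)%N.
Proof.
move=> sB sB' sZ' hZ hB hk Zw Bw hw r1 r2 r3 r4.
have [I1 [a [ha ia sa]]] := indep_maximal (k := k) sB' (indep_sub hZ hB hk)
  (fun i : void => of_void (Z' (of_void _ i)) i) (indep_void (B := B')).
set a' := extend _ a in ia sa.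
have ha' i : Z' (a' i) by case: i.
have [I2 [c [hc ic sc]]] := indep_maximal (k := k) sB'
   (indep_sub (@subset_refl _ _) hB hk) (fun i => hZ _ (ha' i)) ia.
have [|I3 [x [hx ix sx]]] := indep_maximal (Z := Z' `&` B') (k := k) sB _
  (fun i : void => of_void ((Z' `&` B') (of_void _ i)) i) (indep_void (B := B)).
  by apply: indep_sub hk => // u [/hZ].
set x' := extend _ x in ix sx.
have hx' i : (Z' `&` B') (x' i) by case: i.
have k3le : (k3 <= #|{: void + I1 + I2}|)%N.
  have [_ [z [hz iz]]] := r3; rewrite -(card_ord k3).
  by apply: (steinitz sB' _ iz) => i; apply: sc.
have k4le : (k4 <= #|{: (void + I1) + (void + I3)}|)%N.
  have [_ [z [hz iz]]] := r4; rewrite -(card_ord k4).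
  apply: (@steinitz B _ _ _ (extend a' x') sB _ iz) => i.
  have [p hp] := sa _ (hz i).
  (* Removing the [a'] part leaves an element of both [Z'] and [B'], which [x'] spans modulo [B]. *)
  have [q hq] : in_span B x' (z i \- lincomb p a').
    apply: sx; split=> //; apply: subspaceB => //.
    exact: subspace_lincomb.
  exists (fun k => match k with inl i => p i | inr j => q j end).
  move: hq; congr B; apply/funext => s; rewrite lincomb_extend /=.
  by rewrite opprD addrA.
have k2ge : (#|{: void + I1}| <= k2)%N by apply: r2.1 ia.
have k1ge : (#|{: void + I1 + I2 + (void + I3) + unit}| <= k1)%N.
  apply: (r1.1 _ (extend (extend (extend a' c) x') (fun=> w))).
    by case=> [[[i|i]|i]|i] //=; [apply: hZ | apply/hZ; case: (hx' i)].
  move=> p; rewrite 2!lincomb_extend => hp.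
  set q := (p \o inl) \o inl in hp.
  (* Modulo [B'] the terms in [x'] and [w] vanish, and [a'], [c] are independent there. *)
  have q0 : forall i, q i = 0.
    apply: ic; move: (hB _ hp) => {hp} hp.
    have h1 : B' (lincomb ((p \o inl) \o inr) x').
      by apply: subspace_lincomb => // i; case: (hx' i).
    have h2 : B' (lincomb (p \o inr) (fun=> w)) by apply: subspace_lincomb.
    have := subspaceB sB' (subspaceB sB' hp h2) h1.
    by congr B'; apply/funext => s /=; rewrite addrK addrK.
  have {}hp : B (lincomb ((p \o inl) \o inr) x' \+ lincomb (p \o inr) (fun=> w)).
    move: hp; congr B; apply/funext => s /=.
    by rewrite [X in X + _ + _]big1 ?add0r // => i _; rewrite q0 mul0r.
  (* Otherwise [w] would be congruent modulo [B] to a combination of [x'], an element of [Z']. *)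
  have w0 : p (inr tt) = 0.
    apply/eqP/negPn/negP => w0.
    pose g i := - p (inl (inr i)) / p (inr tt).
    apply: (hw (lincomb g x')).
      by apply: subspace_lincomb => // i; case: (hx' i).
    have := subspaceZ (p (inr tt))^-1 sB hp; congr B; apply/funext => s /=.
    rewrite mulrDr addrC /lincomb /=; congr (_ + _).
      by rewrite (big_pred1 tt) /= ?mulKf//; case.
    rewrite mulr_sumr -sumrN; apply: eq_bigr => i _.
    by rewrite /g mulNr mulNr opprK mulrCA mulrA.
  have x0 : forall i, p (inl (inr i)) = 0.
    apply: ix; move: hp; congr B; apply/funext => s /=.
    by rewrite [X in _ + X]big1 ?addr0 // => -[] _; rewrite /= w0 mul0r.
  by case=> [[i|i]|[]]; [apply: q0|apply: x0|].
move: k1ge k2ge k3le k4le; rewrite !card_sum card_unit card_void; lia.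
Qed.

End RelativeRank.

(** * Singular chains *)

Section Chains.
Variables (R : realType) (F : fieldType) (N : nat).
Implicit Types A B : set 'rV[R]_N.

Lemma fsum_finite_supp (T : choiceType) (c G : T -> F) (r : seq T) :
  uniq r -> (forall s, c s != 0 -> s \in r) ->
  \sum_(s \in [set: T]) c s * G s = \sum_(s <- r) c s * G s.
Proof.
move=> ur hr; rewrite (fsbigE r) //=.
  by apply: eq_bigl => i; rewrite in_setT.
move=> s _; apply: contraNeq => h; apply: hr.
by apply: contraNneq h => ->; rewrite mul0r.
Qed.

Lemma finite_suppP (T : choiceType) (c : T -> F) :
  finite_set [set s | c s != 0] ->
  exists2 r : seq T, uniq r & forall s, c s != 0 -> s \in r.
Proof.
move=> /finite_seqP[r hr]; exists (undup r); first exact: undup_uniq.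
by move=> s hs; rewrite mem_undup; have : [set` r] s by rewrite -hr.
Qed.

Lemma boundary_sum k (c : chain R F N k.+1) (r : seq (simplex_map R N k.+1)) t :
  uniq r -> (forall s, c s != 0 -> s \in r) ->
  boundary c t = \sum_(s <- r)
    c s * \sum_(i < k.+2) (-1) ^+ i * (s \o @face_inclusion R k i == t)%:R.
Proof. by move=> ur hr; rewrite /boundary (fsum_finite_supp _ ur hr). Qed.

(** Finite supports matter: the sum defining [boundary] is 0 by convention when infinitely many
    terms are nonzero. Both chains are summed over one list containing the two supports. *)
Lemma boundary_linear k (a : F) (u v : chain R F N k.+1) :
  finite_set [set s | u s != 0] -> finite_set [set s | v s != 0] ->
  boundary (fun s => a * u s + v s) =
  fun t => a * boundary u t + boundary v t.
Proof.
move=> /finite_suppP[r ur hr] /finite_suppP[r' ur' hr']; apply/funext => t.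
pose w := undup (r ++ r').
have uw : uniq w by exact: undup_uniq.
have hu s : u s != 0 -> s \in w by move=> /hr; rewrite mem_undup mem_cat => ->.
have hv s : v s != 0 -> s \in w.
  by move=> /hr'; rewrite mem_undup mem_cat orbC => ->.
rewrite !(boundary_sum _ uw) //.
  rewrite mulr_sumr -big_split; apply: eq_bigr => s _ /=.
  by rewrite mulrDl mulrA.
move=> s h; have [/eqP us0|/hu//] := boolP (u s == 0); apply: hv.
by move: h; rewrite us0 mulr0 add0r.
Qed.

Lemma chain_in_subspace A k : lin_subspace (chain_in (F := F) A (k := k)).
Proof.
split.
  split=> [|s]; last by rewrite eqxx.
  by apply: (@sub_finite_set _ _ set0) => // s /=; rewrite eqxx.
move=> a u v [fu hu] [fv hv]; split.
  apply: (@sub_finite_set _ _ ([set s | u s != 0] `|` [set s | v s != 0])).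
    move=> s /= h; have [/eqP us0|us0] := boolP (u s == 0); [right|by left].
    by move: h; rewrite us0 mulr0 add0r.
  by rewrite finite_setU.
move=> s h; have [/eqP us0|us0] := boolP (u s == 0); last exact: hu.
by apply: hv; move: h; rewrite us0 mulr0 add0r.
Qed.

Lemma cycles1_subspace A : lin_subspace (cycles1 (F := F) A).
Proof.
have [h0 hl] := chain_in_subspace A 1; split.
  split=> //; rewrite /boundary; apply/funext => t.
  by rewrite fsbig1 // => s _; rewrite mul0r.
move=> a u v [cu bu] [cv bv]; split; first exact: hl.
rewrite boundary_linear ?bu ?bv; [|exact: cu.1|exact: cv.1].
by apply/funext => t; rewrite mulr0 addr0.
Qed.

Lemma boundaries1_subspace A : lin_subspace (boundaries1 (F := F) A).
Proof.
have [h0 hl] := chain_in_subspace A 2; split.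
  exists (fun=> 0) => //; rewrite /boundary; apply/funext => t.
  by rewrite fsbig1 // => s _; rewrite mul0r.
move=> a u v [e he <-] [e' he' <-].
exists (fun s => a * e s + e' s); first exact: hl.
by rewrite boundary_linear //; [exact: he.1|exact: he'.1].
Qed.

Lemma chain_inS A B k : A `<=` B ->
  chain_in (F := F) A (k := k) `<=` chain_in (F := F) B (k := k).
Proof.
by move=> AB c [fc hc]; split=> // s /hc[h1 h2 h3]; split=> // x /h2 /AB.
Qed.

Lemma cycles1S A B : A `<=` B -> cycles1 (F := F) A `<=` cycles1 (F := F) B.
Proof. by move=> AB c [hc bc]; split=> //; apply: chain_inS hc. Qed.

Lemma boundaries1S A B :
  A `<=` B -> boundaries1 (F := F) A `<=` boundaries1 (F := F) B.
Proof. by move=> AB c [e he <-]; exists e => //; apply: chain_inS he. Qed.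

Definition simplex1 k (s : simplex_map R N k) : chain R F N k :=
  fun t => (s == t)%:R.

Lemma simplex1_supp k (s t : simplex_map R N k) :
  simplex1 s t != 0 -> t \in [:: s].
Proof.
by rewrite /simplex1 inE [t == s]eq_sym; case: (s == t); rewrite // mulr0n eqxx.
Qed.

Lemma simplex1_in A k (s : simplex_map R N k) :
  singular_simplex A s -> chain_in A (simplex1 s).
Proof.
move=> hs; split; last by move=> t /simplex1_supp; rewrite inE => /eqP ->.
apply: (@sub_finite_set _ _ [set s]) => // t /= /simplex1_supp.
by rewrite inE => /eqP ->.
Qed.

Lemma boundary_simplex1 k (s : simplex_map R N k.+1) :
  boundary (simplex1 s) = fun t =>
    \sum_(i < k.+2) (-1) ^+ i * simplex1 (s \o @face_inclusion R k i) t.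
Proof.
apply/funext => t; rewrite (@boundary_sum _ _ [:: s]) //; last exact: simplex1_supp.
by rewrite big_seq1 /simplex1 eqxx mul1r.
Qed.

(** Summation by parts: the sum is the pairing of the 0-cochain [Phi] with the boundary of [c]. This
    later cancels the corrections at end points. *)
Lemma cycle1_coboundary A c (r : seq (simplex_map R N 1))
    (Phi : simplex_map R N 0 -> F) :
  cycles1 A c -> uniq r -> (forall s, c s != 0 -> s \in r) ->
  \sum_(s <- r) c s * (Phi (s \o @face_inclusion R 0 0) -
                       Phi (s \o @face_inclusion R 0 1)) = 0.
Proof.
move=> [_ bc] ur hr.
pose w := undup ([seq s \o @face_inclusion R 0 0 | s <- r] ++
                 [seq s \o @face_inclusion R 0 1 | s <- r]).
have e (s : simplex_map R N 1) (i : 'I_2) : s \in r ->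
    Phi (s \o @face_inclusion R 0 i) =
    \sum_(t <- w) Phi t * (s \o @face_inclusion R 0 i == t)%:R.
  move=> hs; rewrite (bigD1_seq (s \o @face_inclusion R 0 i)) ?undup_uniq //=.
    rewrite eqxx mulr1 big1 ?addr0 // => t; rewrite eq_sym => /negbTE ->.
    by rewrite mulr0.
  rewrite mem_undup mem_cat; case: i => [[|[|//]]] hi.
    apply/orP; left; rewrite (_ : Ordinal hi = 0); last exact/val_inj.
    by apply/mapP; exists s.
  apply/orP; right; rewrite (_ : Ordinal hi = 1); last exact/val_inj.
  by apply/mapP; exists s.
transitivity (\sum_(t <- w) Phi t * boundary c t); last first.
  by rewrite big1 // => t _; rewrite bc mulr0.
under [RHS]eq_bigr do rewrite (boundary_sum _ ur hr) mulr_sumr.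
rewrite exchange_big /= big_seq [RHS]big_seq; apply: eq_bigr => s hs.
rewrite !e // -sumrB mulr_sumr; apply: eq_bigr => t _.
rewrite big_ord_recl big_ord1 /= expr0 mul1r expr1 mulN1r.
rewrite -mulrBr mulrCA; congr (_ * (_ * (_ - _))).
by rewrite (_ : lift _ _ = 1) //; apply/val_inj.
Qed.

End Chains.

(** * Singular simplices given by formulas *)

Section SingularSimplices.
Variables (R : realType) (F : fieldType) (N : nat).
Implicit Types A B : set 'rV[R]_N.

Definition on_simplex k (h : 'rV[R]_k.+1 -> 'rV[R]_N) : simplex_map R N k :=
  fun x => if `[< @std_simplex R k x >] then h x else 0.

Lemma on_simplex_eq k (h h' : 'rV[R]_k.+1 -> 'rV[R]_N) :
  (forall x, std_simplex x -> h x = h' x) -> on_simplex h = on_simplex h'.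
Proof.
by move=> e; apply/funext => x; rewrite /on_simplex; case: asboolP => // /e.
Qed.

Lemma on_simplex_singular B k (h : 'rV[R]_k.+1 -> 'rV[R]_N) :
  continuous h -> (forall x, std_simplex x -> B (h x)) ->
  singular_simplex B (on_simplex h).
Proof.
move=> ch hB; split.
- apply: (@subspace_eq_continuous _ _ _ (from_subspace _ h)).
    by move=> x; rewrite inE => hx; rewrite /from_subspace /on_simplex asboolT.
  exact: continuous_subspaceT.
- by move=> x hx; rewrite /on_simplex asboolT //; apply: hB.
- by move=> x hx; rewrite /on_simplex asboolF.
Qed.

Lemma face_inclusion_self k i (x : 'rV[R]_k.+1) : face_inclusion i x 0 i = 0.
Proof. by rewrite mxE unlift_none. Qed.

Lemma face_inclusion_lift k i (x : 'rV[R]_k.+1) j :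
  face_inclusion i x 0 (lift i j) = x 0 j.
Proof. by rewrite mxE liftK. Qed.

Lemma std_simplex_face k i (x : 'rV[R]_k.+1) :
  std_simplex (face_inclusion i x) <-> std_simplex x.
Proof.
rewrite /std_simplex /= (bigD1_ord i) //= face_inclusion_self add0r.
under [X in _ /\ X = 1 <-> _]eq_bigr do rewrite face_inclusion_lift.
split=> -[h1 h2]; split=> // j.
  by have := h1 (lift i j); rewrite face_inclusion_lift.
by rewrite mxE; case: unliftP.
Qed.

Lemma on_simplex_face k i (h : 'rV[R]_k.+2 -> 'rV[R]_N) :
  on_simplex h \o face_inclusion i = on_simplex (h \o face_inclusion i).
Proof.
apply/funext => x; rewrite /on_simplex /=; congr (if _ then _ else _).
by apply/asbool_equiv_eq; apply: std_simplex_face.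
Qed.

(** The second barycentric coordinate serves as time: vertex 0 is at time 0 and vertex 1 at time
    1. *)
Definition path1 (g : R -> 'rV[R]_N) : simplex_map R N 1 :=
  on_simplex (fun x => g (x 0 1)).

Definition seg (x y : 'rV[R]_N) : simplex_map R N 1 :=
  path1 (fun t => (1 - t) *: x + t *: y).

Lemma std_simplex1P (x : 'rV[R]_2) : std_simplex x ->
  x 0 0 = 1 - x 0 1 /\ 0 <= x 0 1 <= 1.
Proof.
move=> [h1 h2]; have {}h2 : x 0 0 + x 0 1 = 1.
  by move: h2; rewrite big_ord_recl big_ord1 (_ : lift _ _ = 1) //; apply/val_inj.
by have := h1 0; have := h1 1; lra.
Qed.

Lemma std_simplex2P (x : 'rV[R]_3) : std_simplex x ->
  [/\ 0 <= x 0 1, 0 <= x 0 2 & x 0 1 + x 0 2 <= 1].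
Proof.
move=> [h1 h2]; have {}h2 : x 0 0 + (x 0 1 + x 0 2) = 1.
  move: h2; rewrite 2!big_ord_recl big_ord1 (_ : lift _ _ = 1); last exact/val_inj.
  by rewrite (_ : lift _ _ = 2) //; apply/val_inj.
by split; [exact: h1|exact: h1|]; have := h1 0; lra.
Qed.

(** Boundary of the singular triangle [h u v], where [u], [v] are the barycentric coordinates of
    vertices 1 and 2: the faces opposite to vertices 0, 1, 2 with alternating signs. *)
Definition tri_bd (h : R -> R -> 'rV[R]_N) : chain R F N 1 := fun s =>
  simplex1 F (path1 (fun t => h (1 - t) t)) s -
  simplex1 F (path1 (h 0)) s + simplex1 F (path1 (h ^~ 0)) s.

Lemma triangle_boundary B (h : R -> R -> 'rV[R]_N) :
  continuous (fun x : 'rV[R]_3 => h (x 0 1) (x 0 2)) ->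
  (forall u v, 0 <= u -> 0 <= v -> u + v <= 1 -> B (h u v)) ->
  boundaries1 B (tri_bd h).
Proof.
move=> ch hB.
exists (simplex1 F (on_simplex (fun x : 'rV[R]_3 => h (x 0 1) (x 0 2)))).
  apply: simplex1_in; apply: on_simplex_singular => // x /std_simplex2P[*].
  exact: hB.
rewrite boundary_simplex1; apply/funext => s; rewrite /tri_bd.
rewrite 2!big_ord_recl big_ord1 !on_simplex_face /= /bump /= !addn0 -addrA.
rewrite expr0 mul1r expr1 mulN1r (_ : (-1) ^+ (1 + 1) = 1) ?mul1r; last first.
  by rewrite sqrrN expr1n.
rewrite [X in _ + (_ + X)](_ : _ = simplex1 F (path1 (h^~ 0)) s); last first.
  congr (simplex1 F _ s); apply: on_simplex_eq => x _ /=.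
  set i := lift _ _; rewrite (_ : 2 = i); last exact/val_inj.
  rewrite (_ : 1 = lift i 1 :> 'I_3); last exact/val_inj.
  by rewrite face_inclusion_lift face_inclusion_self.
congr (_ + (- _ + _)); congr (simplex1 F _ s); apply: on_simplex_eq => x.
  move=> /std_simplex1P[e _] /=; rewrite (_ : 2 = lift ord0 1); last exact/val_inj.
  rewrite (_ : 1 = lift ord0 0 :> 'I_3); last exact/val_inj.
  by rewrite !face_inclusion_lift e.
move=> _ /=; set i := lift _ _; rewrite (_ : 2 = lift i 1); last exact/val_inj.
rewrite (_ : 1 = i :> 'I_3); last exact/val_inj.
by rewrite face_inclusion_lift face_inclusion_self.
Qed.

End SingularSimplices.

(** * Rounding paths to a grid *)

Lemma affine_continuous (R : realType) (T : topologicalType) (u v : T -> R)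
    (a b c : R) :
  continuous u -> continuous v ->
  continuous (fun x => a + u x * b + v x * c : R).
Proof.
move=> cu cv x; apply: cvgD; first (apply: cvgD; first exact: cvg_cst).
  by apply: cvgM (cvg_cst _); exact: cu.
by apply: cvgM (cvg_cst _); exact: cv.
Qed.

Section Rounding.
Variables (R : realType) (F : fieldType) (N : nat).
Variables (A B : set 'rV[R]_N) (e0 : R).
Hypothesis e0_gt0 : 0 < e0.
Hypothesis thickAB : forall x y, A x -> `|x - y| <= e0 -> B y.
Variables (rho : 'rV[R]_N -> 'rV[R]_N) (V : seq 'rV[R]_N).
Hypothesis rho_near : forall x, `|x - rho x| <= e0 / 2.
Hypothesis rho_V : forall x, A x -> rho x \in V.

Definition edge (k : 'I_(size V) * 'I_(size V)) : chain R F N 1 :=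
  simplex1 F (seg V`_k.1 V`_k.2).

Definition round_seg (x : 'rV[R]_N) : chain R F N 1 := simplex1 F (seg x (rho x)).

Let bd := boundaries1 (F := F) B.
Let sbd : lin_subspace bd := boundaries1_subspace F B.

Lemma edge_in_span x y : A x -> A y ->
  in_span bd edge (simplex1 F (seg (rho x) (rho y))).
Proof.
move=> /rho_V hx /rho_V hy.
have hx' := hx; have hy' := hy; rewrite -index_mem in hx'.
rewrite -index_mem in hy'.
have := in_span_self edge (Ordinal hx', Ordinal hy') sbd.
by rewrite /edge /= !nth_index.
Qed.

Section Path.
Variable g : R -> 'rV[R]_N.
Hypothesis g_cont : continuous g.
Hypothesis g_A : forall t, A (g t).

Definition subpath (a b : R) : chain R F N 1 :=
  simplex1 F (path1 (fun t => g (a + t * (b - a)))).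

(** The subpath is completed by segments from its end points to their roundings. These corrections
    depend only on the end points, so they telescope under concatenation. *)
Definition roundable (a b : R) : Prop :=
  in_span bd edge
    (fun s => subpath a b s + round_seg (g b) s - round_seg (g a) s).

Lemma g_B t : B (g t).
Proof. by apply: (thickAB (g_A t)); rewrite subrr normr0 ltW. Qed.

(** The triangle with these three faces factors through the path [g], so it stays in [B]. *)
Lemma subpath_cat a b c :
  bd (fun s => subpath b c s - subpath a c s + subpath a b s).
Proof.
have := @triangle_boundary R F N B
  (fun u v => g (a + u * (b - a) + v * (c - a))) _ (fun _ _ _ _ _ => g_B _).
rewrite /tri_bd.
have -> : (fun t => g (a + (1 - t) * (b - a) + t * (c - a))) =
          (fun t => g (b + t * (c - b))).
  by apply/funext => t; congr g; ring.
have -> : (fun v => g (a + 0 * (b - a) + v * (c - a))) =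
          (fun v => g (a + v * (c - a))).
  by apply/funext => t; congr g; ring.
have -> : (fun u => g (a + u * (b - a) + 0 * (c - a))) =
          (fun u => g (a + u * (b - a))).
  by apply/funext => t; congr g; ring.
apply=> x.
apply: (@continuous_comp _ _ _ (fun x : 'rV[R]_3 =>
  a + x 0 1 * (b - a) + x 0 2 * (c - a)) g); last exact: g_cont.
exact: (affine_continuous (@coord_continuous _ _ _ _ _)
                          (@coord_continuous _ _ _ _ _)).
Qed.

Lemma roundable_trans a b c : roundable a b -> roundable b c -> roundable a c.
Proof.
move=> hab hbc.
have h := in_spanD sbd (in_spanD sbd hab hbc)
  (in_spanN sbd (in_spanW edge sbd (subpath_cat a b c))).
move: h; congr in_span; apply/funext => s /=; ring.
Qed.

(* Homotopy from a subpath to the segment between its rounded end points; its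
   square is cut into two triangles along the diagonal. *)
Definition straighten (a b t l : R) : 'rV[R]_N :=
  (1 - l) *: g (a + t * (b - a)) +
  l *: ((1 - t) *: rho (g a) + t *: rho (g b)).

Lemma straighten_continuous (T : topologicalType) (u v : T -> R) a b :
  continuous u -> continuous v ->
  continuous (fun x => straighten a b (u x) (v x)).
Proof.
move=> cu cv x.
have c1 : {for x, continuous (fun x => 1 - v x)}.
  by apply: cvgB; [exact: cvg_cst|exact: cv].
have c2 : {for x, continuous (fun x => 1 - u x)}.
  by apply: cvgB; [exact: cvg_cst|exact: cu].
apply: cvgD; apply: cvgZ.
- exact: c1.
- apply: (@continuous_comp _ _ _ (fun x => a + u x * (b - a)) g); last exact: g_cont.
  by apply: cvgD; [exact: cvg_cst|apply: cvgM (cvg_cst _); exact: cu].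
- exact: cv.
- by apply: cvgD; apply: cvgZ (cvg_cst _); [exact: c2|exact: cu].
Qed.

(** The homotopy is compared with [x], the point of the path at the same time: both rounded end
    points are within [e0 / 2 + e0 / 2] of it, and balls are convex. *)
Lemma straighten_B a b t l :
  (forall r, 0 <= r <= 1 -> `|g (a + r * (b - a)) - g a| <= e0 / 2 /\
                            `|g (a + r * (b - a)) - g b| <= e0 / 2) ->
  0 <= t <= 1 -> 0 <= l <= 1 -> B (straighten a b t l).
Proof.
move=> h t01 l01; set x := g (a + t * (b - a)).
apply: (@thickAB x); first exact: g_A.
have -> : x - straighten a b t l =
  l *: ((1 - t) *: (x - rho (g a)) + t *: (x - rho (g b))).
  rewrite /straighten -/x; apply/rowP => j; rewrite !mxE; ring.
have [ha hb] := h t t01.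
have na : `|x - rho (g a)| <= e0.
  rewrite -(subrK (g a) x) -addrA (splitr e0).
  by apply: le_trans (ler_normD _ _) _; rewrite lerD.
have nb : `|x - rho (g b)| <= e0.
  rewrite -(subrK (g b) x) -addrA (splitr e0).
  by apply: le_trans (ler_normD _ _) _; rewrite lerD.
rewrite normrZ (ger0_norm (andP l01).1).
apply: (@le_trans _ _ (1 * e0)); last by rewrite mul1r.
apply: ler_pM => //; [lra|lra|].
apply: le_trans (ler_normD _ _) _; rewrite !normrZ.
rewrite ger0_norm ?ger0_norm; [|lra|lra].
by move: t01 na nb; set p := `|_|; set q := `|_|; nra.
Qed.

Lemma roundable_small a b :
  (forall r, 0 <= r <= 1 -> `|g (a + r * (b - a)) - g a| <= e0 / 2 /\
                            `|g (a + r * (b - a)) - g b| <= e0 / 2) ->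
  roundable a b.
Proof.
move=> h.
have c1 : continuous (fun x : 'rV[R]_3 => x 0 1) by exact: coord_continuous.
have c2 : continuous (fun x : 'rV[R]_3 => x 0 2) by exact: coord_continuous.
have c12 : continuous (fun x : 'rV[R]_3 => x 0 1 + x 0 2).
  rewrite (_ : (fun x => _) = (fun x : 'rV[R]_3 => 0 + x 0 1 * 1 + x 0 2 * 1)).
    exact: affine_continuous.
  by apply/funext => x; rewrite add0r !mulr1.
(* In the coordinates (t, l) of the square, this triangle has vertices (0,0), (1,0), (1,1) and the
   next one (0,0), (0,1), (1,1). Their common diagonal cancels in the difference. *)
have t1 : bd (tri_bd F (fun u v => straighten a b (u + v) v)).
  apply: triangle_boundary; first exact: straighten_continuous.
  by move=> u v hu hv huv; apply: straighten_B => //; lra.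
have t2 : bd (tri_bd F (fun u v => straighten a b v (u + v))).
  apply: triangle_boundary; first exact: straighten_continuous.
  by move=> u v hu hv huv; apply: straighten_B => //; lra.
have e1 : (fun t => straighten a b (1 - t + t) t) =
          (fun t => (1 - t) *: g b + t *: rho (g b)).
  apply/funext => t; rewrite /straighten subrK mul1r [a + _]addrC subrK.
  by rewrite subrr scale0r add0r scale1r.
have e2 : (fun t => straighten a b (t + 0) 0) = (fun t => g (a + t * (b - a))).
  by apply/funext => t; rewrite /straighten subr0 scale1r scale0r !addr0.
have e3 : (fun t => straighten a b t (1 - t + t)) =
          (fun t => (1 - t) *: rho (g a) + t *: rho (g b)).
  by apply/funext => t; rewrite /straighten subrK subrr scale0r add0r scale1r.
have e4 : (fun t => straighten a b 0 (t + 0)) =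
          (fun t => (1 - t) *: g a + t *: rho (g a)).
  apply/funext => t; rewrite /straighten !addr0 mul0r addr0 subr0 scale1r.
  by rewrite scale0r addr0.
have e5 : (fun t => straighten a b (0 + t) t) = (fun t => straighten a b t (0 + t)).
  by apply/funext => t; rewrite add0r.
have h1 := edge_in_span (g_A a) (g_A b).
have h2 := in_spanD sbd h1 (in_spanW edge sbd (subspaceB sbd t1 t2)).
move: h2; congr in_span; apply/funext => s /=.
rewrite /tri_bd e1 e2 e3 e4 e5 /subpath /round_seg /seg; ring.
Qed.

Lemma roundable_near t : \forall a \near t, roundable a t /\ roundable t a.
Proof.
(* Points within [e0 / 4] of [g t] are within [e0 / 2] of each other, as [roundable_small] asks. *)
have e4 : 0 < e0 / 4 by rewrite divr_gt0.
have /cvgrPdist_le /(_ _ e4) := g_cont (x := t).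
case/nbhs_ballP => r r0 hr.
apply/nbhs_ballP; exists r => // a ta.
have {}ta : `|t - a| < r by exact: ta.
have hg c : `|t - c| <= `|t - a| -> `|g t - g c| <= e0 / 4.
  by move=> hc; apply: hr => /=; apply: le_lt_trans ta.
have hd c c' : `|t - c| <= `|t - a| -> `|t - c'| <= `|t - a| ->
    `|g c - g c'| <= e0 / 2.
  move=> /hg h1 /hg h2; rewrite -(subrK (g t) (g c)) -addrA.
  apply: le_trans (ler_normD _ _) _; rewrite distrC.
  by move: h1 h2; set p := `|_|; set q := `|_|; lra.
have ha : `|t - a| <= `|t - a| by [].
have ht : `|t - t| <= `|t - a| by rewrite subrr normr0.
split; apply: roundable_small => q q01.
  have hq : `|t - (a + q * (t - a))| <= `|t - a|.
    rewrite (_ : t - (a + _) = (1 - q) * (t - a)); last by ring.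
    by rewrite normrM ler_piMl // ger0_norm; lra.
  by split; apply: hd.
have hq : `|t - (t + q * (a - t))| <= `|t - a|.
  rewrite (_ : t - (t + _) = q * (t - a)); last by ring.
  by rewrite normrM ler_piMl // ger0_norm; lra.
by split; apply: hd.
Qed.

(** Connectedness of the line replaces a subdivision of the path: the set of [b] reachable from [a]
    is nonempty, open and closed. *)
Lemma roundable_all a b : roundable a b.
Proof.
have cR : connected [set: R] by apply/connected_intervalP.
suff : [set b | roundable a b] = [set: R] by move/seteqP => [_ /(_ b)]; apply.
apply: cR.
- by exists a; have [] := nbhs_singleton (roundable_near a).
- exists [set b | roundable a b]; last by rewrite setTI.
  rewrite openE => x /= hx; have := roundable_near x; rewrite /interior.
  by apply: filterS => y [_]; apply: roundable_trans.
- exists [set b | roundable a b]; last by rewrite setTI.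
  rewrite -openC openE => x /= hx; have := roundable_near x; rewrite /interior.
  by apply: filterS => y [hyx _] hy; apply: hx; apply: roundable_trans hyx.
Qed.

End Path.
End Rounding.

(** * Finiteness of the ranks between thickenings *)

Section CycleRounding.
Variables (R : realType) (F : fieldType) (N : nat).
Implicit Types A B : set 'rV[R]_N.

Definition clamp (t : R) : R := Num.max 0 (Num.min t 1).

Lemma clamp_continuous : continuous clamp.
Proof.
have h0 : continuous (fun _ : R => 0 : R) by move=> t; exact: cvg_cst.
have h1 : continuous (fun _ : R => 1 : R) by move=> t; exact: cvg_cst.
have hid : continuous (fun t : R => t) by move=> t; exact: cvg_id.
exact: (max_fun_continuous h0 (min_fun_continuous hid h1)).
Qed.

Lemma clamp_itv t : 0 <= clamp t <= 1.
Proof. by rewrite le_max lexx /= ge_max ler01 ge_min lexx orbT. Qed.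

Lemma clamp_id t : 0 <= t <= 1 -> clamp t = t.
Proof. by move=> /andP[h0 h1]; rewrite /clamp min_l // max_r. Qed.

Definition simplex1_pt (t : R) : 'rV[R]_2 :=
  (1 - t) *: delta_mx 0 0 + t *: delta_mx 0 1.

Lemma simplex1_pt0 t : simplex1_pt t 0 0 = 1 - t.
Proof. by rewrite !mxE eqxx /= mulr1 mulr0 addr0. Qed.

Lemma simplex1_pt1 t : simplex1_pt t 0 1 = t.
Proof. by rewrite !mxE /= mulr0 mulr1 add0r. Qed.

Lemma simplex1_pt_std t : 0 <= t <= 1 -> std_simplex (simplex1_pt t).
Proof.
move=> t01; split.
  case=> [[|[|//]]] hi.
    rewrite (_ : Ordinal hi = 0) ?simplex1_pt0; [lra|exact/val_inj].
  rewrite (_ : Ordinal hi = 1) ?simplex1_pt1; [lra|exact/val_inj].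
rewrite big_ord_recl big_ord1 simplex1_pt0 (_ : lift _ _ = 1) ?simplex1_pt1 ?subrK //.
exact/val_inj.
Qed.

Lemma simplex1_ptK (x : 'rV[R]_2) : std_simplex x -> simplex1_pt (x 0 1) = x.
Proof.
move=> /std_simplex1P[e _]; apply/rowP; case=> [[|[|//]]] hi.
  by rewrite (_ : Ordinal hi = 0) ?simplex1_pt0 ?e //; exact/val_inj.
by rewrite (_ : Ordinal hi = 1) ?simplex1_pt1 //; exact/val_inj.
Qed.

Lemma simplex1_pt_continuous : continuous simplex1_pt.
Proof.
move=> t; apply: cvgD; apply: cvgZ; try exact: cvg_cst.
  by apply: cvgB; [exact: cvg_cst|exact: cvg_id].
exact: cvg_id.
Qed.

(** Clamping extends the path of a singular 1-simplex to the whole line, where the connectedness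
    argument takes place. *)
Definition path_of (s : simplex_map R N 1) (t : R) : 'rV[R]_N :=
  s (simplex1_pt (clamp t)).

Lemma path_of_continuous A s : singular_simplex A s -> continuous (path_of s).
Proof.
move=> [cs _ _] t.
have := simplex1_pt_std (clamp_itv t).
move/subspace_continuousP : cs => /[apply] cs.
have h : continuous (simplex1_pt \o clamp).
  move=> u; apply: continuous_comp; [exact: clamp_continuous|].
  exact: simplex1_pt_continuous.
move=> U /cs hU.
have hU' : \forall u \near t,
  ((simplex1_pt \o clamp) @^-1` [set y | std_simplex y -> U (s y)]) u.
  exact: (h t).
suff : \forall u \near t, (path_of s @^-1` U) u by [].
apply: filterS hU' => u; apply; apply: simplex1_pt_std; apply: clamp_itv.
Qed.

Lemma path_of_in A s t : singular_simplex A s -> A (path_of s t).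
Proof. by move=> [_ h _]; apply/h/simplex1_pt_std/clamp_itv. Qed.

Lemma path_ofK A s : singular_simplex A s -> path1 (path_of s) = s.
Proof.
move=> [_ _ h]; apply/funext => x; rewrite /path1 /on_simplex /=.
have [hx|hx] := pselect (std_simplex x); last by rewrite asboolF // h.
rewrite asboolT // /path_of clamp_id ?simplex1_ptK //.
by case: (std_simplex1P hx).
Qed.

(** Deleting vertex 0 leaves the end at time 1; [const_mx 1] is the only point of the standard
    0-simplex. *)
Lemma path_of_face0 s : path_of s 1 = (s \o @face_inclusion R 0 0) (const_mx 1).
Proof.
rewrite /path_of clamp_id ?lexx ?ler01 //=; congr s.
apply/rowP; case=> [[|[|//]]] hi.
  rewrite (_ : Ordinal hi = 0); last exact/val_inj.
  by rewrite simplex1_pt0 face_inclusion_self subrr.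
rewrite (_ : Ordinal hi = 1); last exact/val_inj.
rewrite simplex1_pt1 (_ : 1 = lift 0 0 :> 'I_2); last exact/val_inj.
by rewrite face_inclusion_lift mxE.
Qed.

Lemma path_of_face1 s : path_of s 0 = (s \o @face_inclusion R 0 1) (const_mx 1).
Proof.
rewrite /path_of clamp_id ?lexx ?ler01 //=; congr s.
apply/rowP; case=> [[|[|//]]] hi.
  rewrite (_ : Ordinal hi = 0); last exact/val_inj.
  rewrite simplex1_pt0 [in RHS](_ : 0 = lift 1 0 :> 'I_2); last exact/val_inj.
  by rewrite face_inclusion_lift mxE subr0.
rewrite (_ : Ordinal hi = 1); last exact/val_inj.
by rewrite simplex1_pt1 face_inclusion_self.
Qed.

(** Each simplex, completed by its end corrections, is rounded to edges; over a cycle the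
    corrections add up to zero. *)
Lemma cycle_in_span A B (e0 : R) (rho : 'rV[R]_N -> 'rV[R]_N)
    (V : seq 'rV[R]_N) (c : chain R F N 1) :
  0 < e0 -> (forall x y, A x -> `|x - y| <= e0 -> B y) ->
  (forall x, `|x - rho x| <= e0 / 2) -> (forall x, A x -> rho x \in V) ->
  cycles1 A c -> in_span (boundaries1 B) (edge F (V := V)) c.
Proof.
move=> e0_gt0 thick near hV hc; have [[/finite_suppP[r ur hr] hs] _] := hc.
pose sB := boundaries1_subspace F B.
pose u s : chain R F N 1 := fun v => c s *
  (simplex1 F s v + round_seg F rho (path_of s 1) v
   - round_seg F rho (path_of s 0) v).
have -> : c = fun v => \sum_(s <- r) u s v.
  apply/funext => v; rewrite /u.
  under eq_bigr do rewrite -addrA mulrDr.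
  rewrite big_split /= [X in _ + X](_ : _ = 0) ?addr0; last first.
    under eq_bigr do rewrite path_of_face0 path_of_face1.
    exact: (cycle1_coboundary
      (fun s : simplex_map R N 0 => round_seg F rho (s (const_mx 1)) v) hc ur hr).
  have [vr|vr] := boolP (v \in r).
    rewrite (bigD1_seq v) //= /simplex1 eqxx mulr1 big1 ?addr0 // => s /negbTE ->.
    by rewrite mulr0.
  rewrite big_seq big1; first by apply/eqP; apply: contraNT vr; apply: hr.
  move=> s sr; rewrite /simplex1; case: eqP => [sv|]; last by rewrite mulr0.
  by rewrite -sv sr in vr.
apply: in_span_sum => // s; rewrite /u.
have [/eqP ->|/hs sA] := boolP (c s == 0).
  apply: in_spanW => //; case: sB => h0 _; move: h0; congr boundaries1.
  by apply/funext => v; rewrite mul0r.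
apply: in_spanZ => //.
have := roundable_all F e0_gt0 thick near hV (path_of_continuous sA)
   (fun t => path_of_in t sA) 0 1.
rewrite /roundable /subpath.
have -> : (fun t => path_of s (0 + t * (1 - 0))) = path_of s.
  by apply/funext => t; rewrite add0r subr0 mulr1.
by rewrite (path_ofK sA).
Qed.

Lemma mx_norm_leP (x : 'rV[R]_N) (e : R) :
  0 <= e -> `|x| <= e <-> forall j, `|x 0 j| <= e.
Proof.
move=> e0; rewrite /Num.norm /= mx_normrE; split=> h.
  move=> j; apply: le_trans h.
  exact: (le_bigmax_cond _ (fun ij => `|x ij.1 ij.2|) (j := (0, j))).
by apply: bigmax_le => // -[i j] _ /=; rewrite (ord1 i); apply: h.
Qed.

Lemma grid_rounding A (M e : R) : 0 < e -> (forall x, A x -> `|x| <= M) ->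
  exists (rho : 'rV[R]_N -> 'rV[R]_N) (V : seq 'rV[R]_N),
    (forall x, `|x - rho x| <= e) /\ (forall x, A x -> rho x \in V).
Proof.
move=> e0 hM.
(* On [A] the quotients [x 0 j / e] are below [K] in absolute value, so their floors lie between
   [-K] and [K] and, shifted by [K], index an ordinal below [2K + 1]. *)
pose K := (Num.truncn (M / e)).+1.
pose rho (x : 'rV[R]_N) : 'rV[R]_N := \row_j (e * (Num.floor (x 0 j / e))%:~R).
pose W (h : {ffun 'I_N -> 'I_(K + K).+1}) : 'rV[R]_N :=
  \row_j (e * ((h j)%:Z - K%:Z)%:~R).
exists rho, (codom W); split.
  move=> x; apply/mx_norm_leP; first exact: ltW.
  move=> j; rewrite !mxE; have := floor_itv (x 0 j / e).
  rewrite ler_pdivlMr // ltr_pdivrMr // intrD => /andP[h1 h2].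
  rewrite ger0_norm; last by rewrite subr_ge0 mulrC.
  by move: h2; rewrite mulrDl mul1r mulrC; lra.
move=> x hx; apply/codomP.
have hz j : (- K%:Z <= Num.floor (x 0 j / e) <= K%:Z).
  have hx2 : `|x 0 j / e| < K%:R.
    have hx1 : `|x 0 j| <= M.
      by apply: le_trans (hM _ hx); apply: (mx_norm_leP x (normr_ge0 x)).1.
    rewrite normrM [`|e^-1|]gtr0_norm ?invr_gt0 //.
    apply: le_lt_trans (truncnS_gt _).
    by rewrite ler_pM2r ?invr_gt0.
  move: hx2; rewrite ltr_norml => /andP[h1 h2]; apply/andP; split.
    by rewrite floor_ge_int rmorphN /= ltW.
  by rewrite -ltzD1 floor_lt_int intrD; apply: lt_trans h2 _; rewrite ltrDl.
exists [ffun j => inord (absz (Num.floor (x 0 j / e) + K%:Z))].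
apply/rowP => j; rewrite !mxE ffunE inordK; last first.
  by have := hz j; lia.
by congr (_ * _%:~R); have := hz j; lia.
Qed.

(** The edges of a finite grid span the cycles of [A] modulo boundaries in [B], so [steinitz] bounds
    independent families by the number of edges. *)
Lemma H1_finite A B (M e : R) : 0 < e ->
  (forall x, A x -> `|x| <= M) -> (forall x y, A x -> `|x - y| <= e -> B y) ->
  exists k, indep_bounded (cycles1 (F := F) A) (boundaries1 B) k.
Proof.
move=> e0 hM thick; have e20 : 0 < e / 2 by rewrite divr_gt0.
have [rho [V [near hV]]] := grid_rounding e20 hM.
exists #|{: 'I_(size V) * 'I_(size V)}| => I z hz iz.
apply: (steinitz (boundaries1_subspace F B) _ iz) => i.
exact: (cycle_in_span e0 thick near hV).
Qed.

Lemma has_rank_ex (T : Type) (Z B : set (T -> F)) k :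
  indep_bounded Z B k -> exists k', has_rank Z B k'.
Proof.
move=> hk.
pose Q n := `[< exists z : 'I_n -> T -> F, (forall i, Z (z i)) /\ indep B z >].
have Q0 : exists n, Q n.
  exists 0%N; apply/asboolP; exists (fun=> fun=> 0).
  by split=> [[]|a _ []].
have Qk n : Q n -> (n <= k)%N.
  by move=> /asboolP[z [hz iz]]; rewrite -(card_ord n); apply: hk iz.
case: (ex_maxnP Q0 Qk) => n /asboolP hn hmax; exists n; split=> //.
move=> I z hz iz; apply: hmax; apply/asboolP.
exists (z \o enum_val); split=> [i|a ha i]; first exact: hz.
have := iz (a \o enum_rank); rewrite /lincomb => {}iz.
rewrite -(enum_valK i); apply: iz; move: ha; congr B.
apply/funext => s; rewrite /lincomb [RHS](reindex (@enum_val I (mem I))) /=.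
  by apply: eq_bigr => j _; rewrite enum_valK.
by apply: onW_bij; apply: enum_val_bij.
Qed.

Lemma H1_rankE A B k :
  has_rank (cycles1 (F := F) A) (boundaries1 B) k -> H1_rank F A B = k%:R%:E.
Proof.
move=> [hk hz]; apply/eqP; rewrite eq_le; apply/andP; split.
  apply: ub_ereal_sup => _ [n [z [h1 h2]] <-]; rewrite lee_fin ler_nat.
  by rewrite -(card_ord n); apply: hk h2.
by apply: ereal_sup_ubound; exists k.
Qed.

(** A family independent over [B] and larger than the rank over [B'] has a nontrivial combination
    that bounds in [B']; by independence it does not bound in [B]. *)
Lemma H1_rank_lt A B B' :
  (H1_rank F A B' < H1_rank F A B)%E ->
  exists z, [/\ cycles1 (F := F) A z, ~ boundaries1 B z & boundaries1 B' z].
Proof.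
move=> /ereal_sup_gt[_ [n [z [hz iz]] <-]] hn.
have : ~ (indep (boundaries1 B') z).
  move=> iz'; move: hn; apply/negP; rewrite -leNgt.
  by apply: ereal_sup_ubound; exists n => //; exists z.
move=> /existsNP[a /not_implyP[ha /existsNP[i hi]]].
exists (lincomb a z); split=> //; last by move=> /iz /(_ i).
exact: subspace_lincomb (cycles1_subspace _ _) _.
Qed.

End CycleRounding.

(** * Persistence and stability *)

Section EuclideanNorm.
Variables (R : realType) (N : nat).
Implicit Types (x y z : 'rV[R]_N) (A B : set 'rV[R]_N).

Lemma enorm_ge0 x : 0 <= enorm x.
Proof. exact: sqrtr_ge0. Qed.

Lemma enorm_sqr x : enorm x ^+ 2 = \sum_(j < N) x 0 j ^+ 2.
Proof. by rewrite sqr_sqrtr // sumr_ge0 // => j _; rewrite sqr_ge0. Qed.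

Lemma enormN x : enorm (- x) = enorm x.
Proof. by congr Num.sqrt; apply: eq_bigr => j _; rewrite mxE sqrrN. Qed.

Lemma enorm0 : enorm (0 : 'rV[R]_N) = 0.
Proof. by rewrite /enorm big1 ?sqrtr0 // => j _; rewrite mxE expr0n. Qed.

Lemma enorm_distC x y : enorm (x - y) = enorm (y - x).
Proof. by rewrite -enormN opprB. Qed.

Lemma enorm_coord x j : `|x 0 j| <= enorm x.
Proof.
rewrite -sqrtr_sqr ler_sqrt ?sumr_ge0 // => [|i _]; last exact: sqr_ge0.
by rewrite (bigD1 j) //= lerDl sumr_ge0 // => i _; rewrite sqr_ge0.
Qed.

Lemma enorm0_coord x j : enorm x = 0 -> x 0 j = 0.
Proof. by move=> x0; apply/eqP; rewrite -normr_le0 -x0 enorm_coord. Qed.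

(** Cauchy-Schwarz, by expanding the squared norm of |y| x - |x| y; zero vectors come first because
    |x| |y| is cancelled at the end. *)
Lemma enorm_dot x y : \sum_(j < N) x 0 j * y 0 j <= enorm x * enorm y.
Proof.
have [x0|x0] := eqVneq (enorm x) 0.
  by rewrite x0 mul0r big1 // => j _; rewrite enorm0_coord // mul0r.
have [y0|y0] := eqVneq (enorm y) 0.
  by rewrite y0 mulr0 big1 // => j _; rewrite [y 0 j]enorm0_coord // mulr0.
have px : 0 < enorm x by rewrite lt_def x0 enorm_ge0.
have py : 0 < enorm y by rewrite lt_def y0 enorm_ge0.
have : 0 <= \sum_(j < N) (enorm y * x 0 j - enorm x * y 0 j) ^+ 2.
  by apply: sumr_ge0 => j _; rewrite sqr_ge0.
have -> : \sum_(j < N) (enorm y * x 0 j - enorm x * y 0 j) ^+ 2 =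
  enorm y ^+ 2 * \sum_(j < N) x 0 j ^+ 2 + enorm x ^+ 2 * \sum_(j < N) y 0 j ^+ 2
  - 2 * enorm x * enorm y * \sum_(j < N) x 0 j * y 0 j.
  by rewrite !mulr_sumr -big_split -sumrB /=; apply: eq_bigr => j _; ring.
rewrite -!enorm_sqr; set s := \sum_(j < N) _ => h.
have : 0 <= 2 * (enorm x * enorm y) * (enorm x * enorm y - s).
  by move: h; congr (0 <= _); ring.
by rewrite pmulr_rge0 ?subr_ge0 // !mulr_gt0.
Qed.

Lemma enormD x y : enorm (x + y) <= enorm x + enorm y.
Proof.
rewrite -(@ler_pXn2r _ 2) ?nnegrE ?addr_ge0 ?enorm_ge0 // sqrrD !enorm_sqr.
have -> : \sum_(j < N) (x + y) 0 j ^+ 2 = \sum_(j < N) x 0 j ^+ 2 +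
    (\sum_(j < N) x 0 j * y 0 j) *+ 2 + \sum_(j < N) y 0 j ^+ 2.
  by rewrite -sumrMnl -!big_split /=; apply: eq_bigr => j _; rewrite mxE sqrrD.
by rewrite lerD2r lerD2l lerMn2r enorm_dot.
Qed.

Lemma enorm_le x (e : R) : 0 <= e -> (forall j, `|x 0 j| <= e) ->
  enorm x <= N%:R * e.
Proof.
move=> e0 h; rewrite -(@ler_pXn2r _ 2) ?nnegrE ?mulr_ge0 ?enorm_ge0 //.
rewrite enorm_sqr; apply: (@le_trans _ _ (\sum_(j < N) e ^+ 2)).
  apply: ler_sum => j _.
  by rewrite -(real_normK (num_real (x 0 j))) ler_pXn2r ?nnegrE.
rewrite sumr_const card_ord -[leLHS]mulr_natl exprMn ler_wpM2r ?sqr_ge0 //.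
rewrite -natrX ler_nat expnS expn1; case: (N) => // n; exact: leq_pmull.
Qed.

Lemma mx_norm_enorm x : `|x| <= enorm x.
Proof. by apply/mx_norm_leP; [exact: enorm_ge0|exact: enorm_coord]. Qed.

Lemma enorm_mx_norm x : enorm x <= N%:R * `|x|.
Proof. by apply: enorm_le => //; apply/mx_norm_leP. Qed.

Lemma dist_to_has_inf A x : A !=set0 -> has_inf [set enorm (x - y) | y in A].
Proof.
move=> [y Ay]; split; first by exists (enorm (x - y)), y.
by exists 0 => _ [z _ <-]; exact: enorm_ge0.
Qed.

Lemma dist_to_le A x y : A y -> dist_to A x <= enorm (x - y).
Proof.
move=> Ay; apply: ge_inf; last by exists y.
by exists 0 => _ [z _ <-]; exact: enorm_ge0.
Qed.

Lemma le_dist_to A x (e : R) : A !=set0 ->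
  (forall y, A y -> e <= enorm (x - y)) -> e <= dist_to A x.
Proof.
move=> [y Ay] h; apply: lb_le_inf; first by exists (enorm (x - y)), y.
by move=> _ [z Az <-]; apply: h.
Qed.

Lemma dist_to_ge0 A x : A !=set0 -> 0 <= dist_to A x.
Proof. by move=> A0; apply: le_dist_to => // y _; apply: enorm_ge0. Qed.

Lemma dist_to_near A A' x (e : R) : A !=set0 ->
  (forall y, A y -> exists2 y', A' y' & enorm (y - y') <= e) ->
  dist_to A' x <= dist_to A x + e.
Proof.
move=> A0 h; rewrite -lerBlDr; apply: le_dist_to => // y /h[y' Ay' ye].
rewrite lerBlDr; apply: le_trans (dist_to_le x Ay') _.
rewrite -(subrKA y x); apply: le_trans (enormD _ _) _.
by rewrite lerD.
Qed.

Lemma dist_toD A x y : A !=set0 -> dist_to A y <= dist_to A x + enorm (x - y).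
Proof.
move=> A0; rewrite -lerBlDr; apply: le_dist_to => // z Az.
rewrite lerBlDr; apply: le_trans (dist_to_le y Az) _.
rewrite (enorm_distC x y) (_ : y - z = (x - z) + (y - x)) ?enormD //.
by rewrite [RHS]addrC subrKA.
Qed.

Lemma dist_sublevel_mono A (r s : R) :
  r <= s -> dist_sublevel A r `<=` dist_sublevel A s.
Proof. by move=> rs x /= /le_trans; apply. Qed.

(** The extra 1 allows for an infimum that is not attained. *)
Lemma dist_sublevel_bounded A (M r : R) : A !=set0 ->
  (forall x, A x -> enorm x <= M) ->
  forall x, dist_sublevel A r x -> `|x| <= r + 1 + M.
Proof.
move=> A0 hM z /= hz; have := @inf_adherent _ _ 1 ltr01 (dist_to_has_inf z A0).
move=> [_ [y Ay <-]] h; apply: le_trans (mx_norm_enorm z) _.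
rewrite -(subrK y z); apply: le_trans (enormD _ _) _.
rewrite lerD ?hM //; by apply/ltW/(lt_le_trans h); rewrite lerD2r.
Qed.

(** Distances are nonnegative, so the sublevel set is empty, whereas a simplex of the support would
    send a vertex into it. *)
Lemma cycles1_neg_sublevel (F : fieldType) A (r : R) (w : chain R F N 1) :
  A !=set0 -> r < 0 -> cycles1 (dist_sublevel A r) w -> w = fun=> 0.
Proof.
move=> A0 r0 [[_ hw] _]; apply/funext => t; apply/eqP/negPn/negP.
move=> /hw[_ tA _]; have /tA : std_simplex (delta_mx 0 0 : 'rV[R]_2).
  split=> [j|]; first by rewrite !mxE ler0n.
  by rewrite big_ord_recl big_ord1 !mxE /= addr0.
by move=> /le_lt_trans /(_ r0); rewrite ltNge dist_to_ge0.
Qed.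

End EuclideanNorm.

(** * From persistent classes to diagram points and back *)

Section PersistentClasses.
Variables (R : realType) (F : fieldType) (N : nat) (A : set 'rV[R]_N) (M : R).
Hypotheses (A0 : A !=set0) (A_bounded : forall x, A x -> enorm x <= M).

Let S (r : R) := dist_sublevel A r.
Let cyc r := cycles1 (F := F) (S r).
Let bds r := boundaries1 (F := F) (S r).

Let sbd r : lin_subspace (bds r). Proof. exact: boundaries1_subspace. Qed.
Let scyc r : lin_subspace (cyc r). Proof. exact: cycles1_subspace. Qed.

Let bdsS r s : r <= s -> bds r `<=` bds s.
Proof. by move=> rs; apply/boundaries1S/dist_sublevel_mono. Qed.
Let cycS r s : r <= s -> cyc r `<=` cyc s.
Proof. by move=> rs; apply/cycles1S/dist_sublevel_mono. Qed.

Lemma H1_persistent_bounded (q r : R) : q < r ->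
  exists k, indep_bounded (cyc q) (bds r) k.
Proof.
(* The Euclidean norm is at most [N] times the sup norm; [N.+1] keeps the divisor positive when [N]
   is 0. *)
move=> qr; apply: (@H1_finite _ _ _ _ _ (q + 1 + M) ((r - q) / N.+1%:R)).
- by rewrite divr_gt0 ?subr_gt0.
- exact: dist_sublevel_bounded.
move=> x y /= hx hxy; apply: le_trans (dist_toD x y A0) _.
rewrite -(subrKC q r) lerD //; apply: le_trans (enorm_mx_norm _) _.
apply: (@le_trans _ _ (N.+1%:R * `|x - y|)).
  by rewrite ler_wpM2r // ler_nat.
by rewrite mulrC -ler_pdivlMr.
Qed.

(* Some class is born in ]p, q] and dies in ]r, s]; for q-tame modules this is
   positivity of [rectangle_measure]. *)
Definition lives (p q r s : R) : Prop :=
  exists w, [/\ cyc q w, bds s w & forall w', cyc p w' -> ~ bds r (w \- w')].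

Lemma lives_mono p q r s p' q' r' s' :
  p' <= p -> q <= q' -> r' <= r -> s <= s' ->
  lives p q r s -> lives p' q' r' s'.
Proof.
move=> hp hq hr hs [w [wq ws hw]]; exists w; split.
- exact: cycS wq.
- exact: bdsS ws.
by move=> w' /(cycS hp) /hw nw /(bdsS hr).
Qed.

(** If [w] is homologous at level [r] to a cycle present at [p'], that cycle is the early class;
    otherwise [w] itself is born after [p']. *)
Lemma lives_split_birth p p' q r s : r <= s ->
  lives p q r s -> lives p p' r s \/ lives p' q r s.
Proof.
move=> rs [w [wq ws hw]].
have [[w' [w'p' hw']]|no] := pselect (exists w', cyc p' w' /\ bds r (w \- w')).
  left; exists w'; split=> //.
    have := subspaceB (sbd s) ws (bdsS rs hw').
    by congr (bds s); apply/funext => t /=; rewrite opprB addrC subrK.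
  move=> v /hw nv hv; apply: nv; have := subspaceD (sbd r) hw' hv.
  by congr (bds r); apply/funext => t /=; rewrite addrA subrK.
by right; exists w; split=> // w' h1 h2; apply: no; exists w'.
Qed.

(** If [w] is homologous at level [r'] to a cycle [w'] present at [p], then [w \- w'] dies by [r'];
    otherwise [w] itself survives [r']. *)
Lemma lives_split_death p q r r' s : p <= q ->
  lives p q r s -> lives p q r r' \/ lives p q r' s.
Proof.
move=> pq [w [wq ws hw]].
have [[w' [w'p hw']]|no] := pselect (exists w', cyc p w' /\ bds r' (w \- w')).
  left; exists (w \- w'); split=> //.
    exact/(subspaceB (scyc q))/(cycS pq).
  move=> v hv; have := hw _ (subspaceD (scyc p) w'p hv); apply: contra_not.
  by congr (bds r); apply/funext => t /=; rewrite opprD addrA.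
by right; exists w; split=> // w' h1 h2; apply: no; exists w'.
Qed.

(** Two suprema stand for nested rectangles: [y] is the last level to which a death can be
    postponed, then [x] the last to which a birth can be, uniformly in the death windows around [y].
    Splitting beyond a supremum leaves the class on the near side. *)
Lemma lives_point p0 q0 r0 s0 : p0 <= q0 -> q0 < r0 -> r0 <= s0 ->
  lives p0 q0 r0 s0 ->
  exists x y, [/\ x <= q0, r0 <= y &
    forall p q r s, p < x < q -> q < r -> r < y < s -> lives p q r s].
Proof.
move=> pq0 qr0 rs0 h0.
pose Y := [set u | r0 <= u <= s0 /\ lives p0 q0 u s0].
have Yr0 : Y r0 by split=> //; rewrite lexx.
have supY : has_sup Y by split; [exists r0|exists s0 => u [/andP[_ ?] _]].
set y := sup Y.
have r0y : r0 <= y by apply: (ub_le_sup supY.2).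
have hy r s : r < y < s -> lives p0 q0 r s.
  move=> /andP[ry ys].
  have hr : lives p0 q0 r s0.
    have [|u [_ hu] ru] := @sup_adherent _ _ (y - r) _ supY; first by rewrite subr_gt0.
    by move: ru; rewrite opprB addrC subrK => /ltW ru; apply: lives_mono hu.
  have [s0s|ss0] := leP s0 s; first exact: lives_mono hr.
  have [//|hs] := lives_split_death s pq0 hr.
  have : s <= y; last by rewrite leNgt ys.
  apply: (ub_le_sup supY.2); split=> //.
  by rewrite (ltW ss0) (le_trans r0y) // ltW.
pose X := [set u | u <= q0 /\ forall r s, r < y < s -> lives u q0 r s].
have supX : has_sup X by split; [exists p0|exists q0 => u []].
set x := sup X.
have xq0 : x <= q0 by apply: ge_sup => [|u []//]; exists p0.
exists x, y; split=> // p q r s /andP[px xq] qr /andP[ry ys].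
have hp r' s' : r' < y < s' -> lives p q0 r' s'.
  move=> hrs; have [|u [_ hu] ru] := @sup_adherent _ _ (x - p) _ supX.
    by rewrite subr_gt0.
  move: ru; rewrite opprB addrC subrK => /ltW ru.
  by apply: lives_mono (hu _ _ hrs).
have [q0q|qq0] := leP q0 q.
  by apply: lives_mono (hp r s _) => //; rewrite ry.
have : ~ X q.
  by move=> /(ub_le_sup supX.2); rewrite leNgt xq.
move=> /not_andP[|/existsNP[r1 /existsNP[s1 /not_implyP[/andP[ry1 ys1] no]]]].
  by rewrite ltW.
(* In the intersection of the two windows a single split yields the goal or contradicts [no]. *)
have hrs2 : Num.max r r1 < y < Num.min s s1.
  by rewrite gt_max ry ry1 lt_min ys ys1.
have [|h|h] := @lives_split_birth p q q0 _ _ _ (hp _ _ hrs2).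
- by have /andP[h1 h2] := hrs2; apply/ltW/(lt_trans h1).
- by apply: lives_mono h => //; rewrite ?le_max ?ge_min lexx.
by case: no; apply: lives_mono h => //; rewrite ?le_max ?ge_min lexx orbT.
Qed.

(** All four ranks are natural numbers, so the strict inequality of [rank_rectangle] is a gap of at
    least 1. *)
Lemma lives_rectangle p q r s : p < q -> q < r -> r < s -> lives p q r s ->
  (1 <= rectangle_measure F A p q r s)%E.
Proof.
move=> pq qr rs [w [wq ws hw]].
have rk u v : u < v -> exists k, has_rank (cyc u) (bds v) k.
  by move=> /H1_persistent_bounded[k]; exact: has_rank_ex.
have [k1 h1] := rk q r qr.
have [k2 h2] := rk p s (lt_trans pq (lt_trans qr rs)).
have [k3 h3] := rk q s (lt_trans qr rs).
have [k4 h4] := rk p r (lt_trans pq qr).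
have [k hk] := H1_persistent_bounded qr.
have := rank_rectangle (sbd r) (sbd s) (scyc p) (cycS (ltW pq)) (bdsS (ltW rs))
  hk wq ws hw h1 h2 h3 h4.
rewrite /rectangle_measure /H1_persistent_rank.
rewrite (H1_rankE h1) (H1_rankE h2) (H1_rankE h3) (H1_rankE h4) => h.
rewrite -!EFinB lee_fin; move: h.
rewrite -(ler_nat R) -natr1 !natrD; lra.
Qed.

Lemma lives_dgm p0 q0 r0 s0 : p0 <= q0 -> q0 < r0 -> r0 <= s0 ->
  lives p0 q0 r0 s0 ->
  exists z, [/\ dgm F A z, z.1 <= q0 & r0 <= z.2].
Proof.
move=> h1 h2 h3 /(lives_point h1 h2 h3)[x [y [xq ry h]]].
exists (x, y); split=> //; split=> /=.
  exact/(le_lt_trans xq)/(lt_le_trans h2).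
apply: (@lt_le_trans _ _ 1%E); first exact: lte01.
apply: le_ereal_inf_tmp => _ [p [q [r [s [hx qr hy ->]]]]].
have [[hpx hxq] [hry hys]] := (andP hx, andP hy).
apply: lives_rectangle => //; [exact: lt_trans hxq|exact: lt_trans hys|].
exact: h.
Qed.

(** In a rectangle starting at -1, where there are no nonzero cycles, the measure reduces to a
    difference of two ranks; its positivity gives a class that dies between [r] and [s]. *)
Lemma dgm_birth0_cycle d q r s : dgm F A (0, d) -> 0 < q -> q < r -> r < d ->
  d < s -> exists z, [/\ cyc q z, ~ bds r z & bds s z].
Proof.
move=> [_ /= hd] q0 qr rd ds; apply: H1_rank_lt.
have neg u : has_rank (cyc (-1)) (bds u) 0.
  split; last by exists (fun=> fun=> 0); split=> [[]|a _ []].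
  move=> I z hz iz; rewrite leqn0; apply/negPn/negP; rewrite -lt0n => /card_gt0P[i _].
  have z0 j : z j = fun=> 0 := cycles1_neg_sublevel A0 (ltrN10 R) (hz j).
  have := iz (fun=> 1); move=> /(_ _ i) /eqP; rewrite oner_eq0 => h.
  suff : false by []; apply: h; have [hb _] := sbd u; move: hb; congr (bds u).
  by apply/funext => t; rewrite /lincomb big1 // => j _; rewrite z0 mulr0.
have : (0 < rectangle_measure F A (-1) q r s)%E.
  apply: (lt_le_trans hd); apply: ereal_inf_lbound.
  by exists (-1), q, r, s; rewrite ltrN10 q0 qr rd ds.
rewrite /rectangle_measure /H1_persistent_rank.
rewrite !(H1_rankE (neg _)) !sube0.
by case: (H1_rank _ _ _) => [a||]; case: (H1_rank _ _ _) => [b||] //=;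
  rewrite ?lte_fin ?subr_gt0 ?ltry ?ltNyr.
Qed.

End PersistentClasses.

(** Sublevel sets of [A'] lie in those of [A], which lie in those of [A'] with level raised by
    [eta]. A cycle of [A] is thus one of [A'] slightly later, and cannot bound earlier there. *)
Lemma dgm_stable (R : realType) (F : fieldType) (N : nat)
    (A A' : set 'rV[R]_N) (M eta c d : R) :
  A' !=set0 -> A' `<=` A -> (forall x, A x -> enorm x <= M) ->
  (forall x, A x -> exists2 x', A' x' & enorm (x - x') <= eta) ->
  0 <= eta -> eta < c -> 4 * c <= d -> dgm F A (0, d) ->
  exists z, [/\ dgm F A' z, z.1 < c & 2 * c <= z.2 - z.1].
Proof.
move=> A'0 A'A hM near eta0 etac cd hd.
have A0 : A !=set0 by case: A'0 => x /A'A; exists x.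
have s1 r : dist_sublevel A r `<=` dist_sublevel A' (r + eta).
  move=> x /= hx; apply: le_trans (dist_to_near x A0 near) _.
  by rewrite lerD2r.
have s2 r : dist_sublevel A' r `<=` dist_sublevel A r.
  move=> x /=; apply: le_trans; apply: le_dist_to => // y /A'A.
  exact: dist_to_le.
(* Birth in [A'] comes by [(c - eta) / 2 + eta], less than [c], and death not before [3 * c], which
   is less than [d]; hence a persistence of at least [2 * c]. *)
have [|||| z [z1 z2 z3]] :=
  dgm_birth0_cycle A0 (q := (c - eta) / 2) (r := 3 * c) (s := d + 1) hd.
- by rewrite divr_gt0 ?subr_gt0.
- lra.
- lra.
- lra.
have hl : lives F A' (-1) ((c - eta) / 2 + eta) (3 * c) (d + 1 + eta).
  exists z; split.
  - exact: cycles1S z1.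
  - exact: boundaries1S z3.
  move=> w /(cycles1_neg_sublevel A'0 (ltrN10 R)) w0 hz; apply: z2.
  have : boundaries1 (dist_sublevel A' (3 * c)) z.
    by move: hz; congr boundaries1; apply/funext => t; rewrite w0 /= subr0.
  exact: boundaries1S.
have [||||z' [h1 h2 h3]] := lives_dgm (M := M) A'0 _ _ _ _ hl.
- by move=> x /A'A /hM.
- lra.
- lra.
- lra.
by exists z'; split=> //; lra.
Qed.

(** * Deterministic analysis of the test *)

Section Signal.
Variables (R : realType) (delta L K eps : R) (f : R -> R) (m : nat) (tau : R).
Hypotheses (delta_gt0 : 0 < delta) (freg : regular delta L K eps f).
Variables Tmin Tmax : R.
Hypothesis hT : Tmin < Tmax.

Lemma regular_bound_ge0 : 0 <= L.
Proof. by have [_ _ /(_ 0)[h _] _] := freg; apply: le_trans h. Qed.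

Lemma regular_continuous : continuous f.
Proof.
have [[df _ _] _ _ _] := freg => t.
by apply: differentiable_continuous; apply/derivable1_diffP.
Qed.

Lemma regular_lipschitz s t : `|f s - f t| <= L * `|s - t|.
Proof.
wlog st : s t / s <= t.
  move=> h; have [/h//|/ltW/h] := leP s t.
  by rewrite distrC [in `|s - t|]distrC.
have [[df _ _] _ bd _] := freg.
have [||c _ e] := @MVT_segment R f (derive1 f) s t st.
- by move=> x _; rewrite derive1E; apply/derivableP/df.
- exact/continuous_subspaceT/regular_continuous.
rewrite distrC e normrM [in X in _ <= X]distrC ler_wpM2r //.
by case: (bd c).
Qed.

(** Were [f] constant on the interval, its first two derivatives would vanish at the midpoint,
    against [delta > 0]. *)
Lemma regular_nonconstant :
  exists u v, [/\ Tmin <= u <= Tmax, Tmin <= v <= Tmax & f u < f v].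
Proof.
apply: contrapT => no.
have const s : Tmin < s < Tmax -> f s = f Tmin.
  move=> /andP[/ltW h1 /ltW h2]; apply/eqP; rewrite eq_le; apply/andP.
  split; rewrite leNgt; apply/negP => h; apply: no.
    by exists Tmin, s; rewrite h1 h2 lexx (ltW hT).
  by exists s, Tmin; rewrite h1 h2 lexx (ltW hT).
have near_in s : Tmin < s < Tmax -> \forall x \near s, Tmin < x < Tmax.
  move=> hs; have := @near_in_itvoo R Tmin Tmax s.
  by rewrite !in_itv /= => /(_ hs); apply: filterS => x; rewrite in_itv.
have d1 s : Tmin < s < Tmax -> derive1 f s = 0.
  move=> hs; rewrite derive1E (@near_eq_derive _ _ _ f (cst (f Tmin))) ?derive_cst //.
  by apply: filterS (near_in _ hs) => x /const.
pose mid := (Tmin + Tmax) / 2.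
have hm : Tmin < mid < Tmax by rewrite (midf_lt hT).1 (midf_lt hT).2.
have d2 : derive1n 2 f mid = 0.
  rewrite derive1nS derive1n1 derive1E.
  rewrite (@near_eq_derive _ _ _ (derive1 f) (cst 0)) ?derive_cst //.
  by apply: filterS (near_in _ hm) => x /d1.
have [_ /(_ mid) h _ _] := freg; move: h.
by rewrite d1 // d2 normr0; case; rewrite leNgt delta_gt0.
Qed.

(** Lipschitz constant of the sliding window curve for the Euclidean norm, by the crude bound of
    [enorm_le]. *)
Let Lam := m.+1%:R * L.

Lemma Lam_ge0 : 0 <= Lam.
Proof. by rewrite mulr_ge0 // regular_bound_ge0. Qed.

Lemma SW_lipschitz s t : enorm (SW f m tau s - SW f m tau t) <= Lam * `|s - t|.
Proof.
rewrite /Lam -mulrA; apply: enorm_le; first by rewrite mulr_ge0 ?regular_bound_ge0.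
move=> j; rewrite !mxE; apply: le_trans (regular_lipschitz _ _) _.
by rewrite opprD addrACA subrr addr0.
Qed.

Lemma SW_curve_bounded x : SW_curve f m tau Tmin Tmax x ->
  enorm x <= enorm (SW f m tau Tmin) + Lam * (Tmax - Tmin).
Proof.
move=> [s]; rewrite /= in_itv /= => /andP[h1 h2] <-.
rewrite -(subrK (SW f m tau Tmin) (SW f m tau s)) [leRHS]addrC.
apply: le_trans (enormD _ _) _; rewrite lerD2r.
apply: le_trans (SW_lipschitz _ _) _; rewrite ler_wpM2l ?Lam_ge0 //.
by rewrite ger0_norm ?subr_ge0 // lerD2r.
Qed.

(** * Hausdorff distances and critical value of a fixed sample *)

Section Sample.
Variables (n : nat) (ts : 'I_n -> R).
Hypothesis ts_in : forall i, Tmin <= ts i <= Tmax.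

Let X := SW_sample f (m := m) tau ts.
Let XJ := SW_subsample f (m := m) tau ts.

(** A condition on the times alone, whose probability is accessible; [Lam] turns it into Hausdorff
    bounds. *)
Definition spread (J : {set 'I_n}) (h : R) : Prop :=
  forall s, Tmin <= s <= Tmax -> exists2 i, i \in J & `|ts i - s| <= h.

Lemma sample_in_curve : X `<=` SW_curve f m tau Tmin Tmax.
Proof. by move=> _ [i _ <-]; exists (ts i) => //=; rewrite in_itv /= ts_in. Qed.

Lemma sample_near h s : spread [set: 'I_n] h -> Tmin <= s <= Tmax ->
  exists2 x, X x & enorm (SW f m tau s - x) <= Lam * h.
Proof.
move=> sp /sp[i _ hi]; exists (SW f m tau (ts i)); first by exists i.
apply: le_trans (SW_lipschitz _ _) _; rewrite distrC.
by rewrite ler_wpM2l ?Lam_ge0.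
Qed.

Lemma hausdorff_subsample_le J h (r : R) : spread J h -> Lam * h <= r ->
  hausdorff X (XJ J) <= r.
Proof.
move=> sp hr.
(* A member of [J] makes both suprema range over nonempty sets and shows that [h] is nonnegative. *)
have [i0 i0J hi0] : exists2 i, i \in J & `|ts i - Tmin| <= h.
  by apply: sp; rewrite lexx ltW.
have r0 : 0 <= r.
  by apply: le_trans hr; rewrite mulr_ge0 ?Lam_ge0 // (le_trans _ hi0).
rewrite /hausdorff ge_max; apply/andP; split.
  apply: ge_sup.
    exists (dist_to (XJ J) (SW f m tau (ts i0))), (SW f m tau (ts i0)) => //.
    by exists i0.
  move=> _ [_ [i _ <-] <-]; have [j jJ hj] := sp _ (ts_in i).
  apply: le_trans (dist_to_le _ (y := SW f m tau (ts j)) _) _; first by exists j.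
  apply: le_trans (SW_lipschitz _ _) _; apply: le_trans hr.
  by rewrite ler_wpM2l ?Lam_ge0 // distrC.
apply: ge_sup.
  exists (dist_to X (SW f m tau (ts i0))), (SW f m tau (ts i0)) => //.
  by exists i0.
move=> _ [_ [i _ <-] <-].
apply: le_trans (dist_to_le _ (y := SW f m tau (ts i)) _) _; first by exists i.
by rewrite subrr enorm0.
Qed.

Variables (u v : R).
Hypotheses (hu : Tmin <= u <= Tmax) (hv : Tmin <= v <= Tmax) (fuv : f u < f v).

(* Among the b + 1 equally spaced values of f, two would have to be close to
   the value at the same subsampled time. *)
Lemma subsample_far_value (J : {set 'I_n}) (b : nat) : #|J| = b -> (0 < b)%N ->
  exists2 s, Tmin <= s <= Tmax &
    forall i, i \in J -> (f v - f u) / (2 * b%:R) <= `|f s - f (ts i)|.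
Proof.
move=> Jb b0; apply: contrapT => no.
have br : 0 < b%:R :> R by rewrite ltr0n.
have l0 : 0 <= (f v - f u) / b%:R by rewrite divr_ge0 // subr_ge0 ltW.
have hs (k : 'I_b.+1) : exists s, Tmin <= s <= Tmax /\
    f s = f u + k%:R * ((f v - f u) / b%:R).
  have : f u <= f u + k%:R * ((f v - f u) / b%:R) <= f v.
    apply/andP; split; first by rewrite lerDl mulr_ge0.
    rewrite -lerBrDl mulrA ler_pdivrMr // mulrC ler_wpM2l ?subr_ge0 ?(ltW fuv) //.
    by rewrite ler_nat -ltnS.
  set y := _ + _ => hy.
  have [uv|vu] := leP u v.
    have [||c] := @IVT R f u v y uv.
    - exact/continuous_subspaceT/regular_continuous.
    - by rewrite min_l ?max_r ?(ltW fuv).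
    rewrite in_itv /= => /andP[h1 h2] <-; exists c; split=> //.
    by rewrite (le_trans (andP hu).1 h1) (le_trans h2 (andP hv).2).
  have [||c] := @IVT R f v u y (ltW vu).
  - exact/continuous_subspaceT/regular_continuous.
  - by rewrite min_r ?max_l ?(ltW fuv).
  rewrite in_itv /= => /andP[h1 h2] <-; exists c; split=> //.
  by rewrite (le_trans (andP hv).1 h1) (le_trans h2 (andP hu).2).
have [s hs'] := choice hs.
have hi (k : 'I_b.+1) : exists i, i \in J /\
    `|f (s k) - f (ts i)| < (f v - f u) / (2 * b%:R).
  apply: contrapT => nk; apply: no; exists (s k); first by case: (hs' k).
  by move=> i iJ; rewrite leNgt; apply/negP => h; apply: nk; exists i.
have [g hg] := choice hi.
have : ~ injective g.
  move=> ig; have : (#|[set g k | k in 'I_b.+1]%SET| <= #|J|)%N.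
    by apply/subset_leq_card/fintype.subsetP => _ /imsetP[k _ ->]; case: (hg k).
  by rewrite card_imset // card_ord Jb ltnn.
apply=> k k' e; apply/eqP/negPn/negP => kk'.
have [_ h1] := hg k; have [_ h2] := hg k'; rewrite -e in h2.
have [_ e1] := hs' k; have [_ e2] := hs' k'.
have h : `|f (s k) - f (s k')| < (f v - f u) / b%:R.
  rewrite -(subrKA (f (ts (g k)))).
  apply: le_lt_trans (ler_normD _ _) _; rewrite [X in _ + X < _]distrC.
  have -> : (f v - f u) / b%:R =
    (f v - f u) / (2 * b%:R) + (f v - f u) / (2 * b%:R).
    by field; apply/lt0r_neq0.
  exact: ltrD.
move: h; rewrite e1 e2 opprD addrACA subrr add0r -mulrBl normrM.
rewrite [X in _ * X < _]ger0_norm //.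
rewrite gtr_pMl ?divr_gt0 ?subr_gt0 // ltNge => /negP; apply.
have /orP[kl|kl] : (k < k')%N || (k' < k)%N.
  by rewrite -neq_ltn; apply: contraNneq kk' => /val_inj ->.
  rewrite distrC ger0_norm ?subr_ge0 ?ler_nat ?(ltnW kl) //.
  by rewrite -natrB ?(ltnW kl) // ler1n subn_gt0.
rewrite ger0_norm ?subr_ge0 ?ler_nat ?(ltnW kl) //.
by rewrite -natrB ?(ltnW kl) // ler1n subn_gt0.
Qed.

(** The first coordinate of the curve is [f], so a value far from the subsampled ones gives a far
    curve point; replacing it by a nearby sample point costs [Lam * h]. *)
Lemma hausdorff_subsample_ge (J : {set 'I_n}) (b : nat) h :
  spread [set: 'I_n] h -> #|J| = b -> (0 < b)%N ->
  (f v - f u) / (2 * b%:R) - Lam * h <= hausdorff X (XJ J).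
Proof.
move=> sp Jb b0; have [s hs far] := subsample_far_value Jb b0.
have [i0 i0J] : exists i, i \in J by apply/card_gt0P; rewrite Jb.
have XJ0 : XJ J !=set0 by exists (SW f m tau (ts i0)); exists i0.
have [x Xx hx] := sample_near sp hs.
apply: (@le_trans _ _ (dist_to (XJ J) x)); last first.
  rewrite /hausdorff le_max; apply/orP; left; apply: ub_le_sup; last by exists x.
  (* An upper bound on the distances, needed for [sup] to dominate them. *)
  exists (enorm (SW f m tau (ts i0)) +
          (enorm (SW f m tau Tmin) + Lam * (Tmax - Tmin))).
  move=> _ [z Xz <-].
  apply: le_trans (dist_to_le _ (y := SW f m tau (ts i0)) _) _; first by exists i0.
  apply: le_trans (enormD _ _) _; rewrite enormN [leRHS]addrC lerD2r.
  exact/SW_curve_bounded/sample_in_curve.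
rewrite lerBlDr; apply: (@le_trans _ _ (dist_to (XJ J) (SW f m tau s))).
  apply: le_dist_to => // _ [i iJ <-].
  apply: le_trans (far i iJ) _; apply: le_trans (enorm_coord _ 0).
  by rewrite !mxE !mul0r !addr0.
apply: le_trans (dist_toD x _ XJ0) _.
by rewrite lerD2l enorm_distC.
Qed.

(** [Q] will be the covering failure, which replaces the Hausdorff event by one whose probability
    can be computed. *)
Lemma subsampling_tail_le (b : nat) h (r : R) (Q : pred {set 'I_n}) :
  Lam * h <= r -> (forall J : {set 'I_n}, ~~ Q J -> spread J h) ->
  subsampling_tail f m tau b ts r <=
  'C(n, b)%:R^-1 * \sum_(J : {set 'I_n} | #|J| == b) (Q J)%:R.
Proof.
move=> hr hQ; rewrite ler_wpM2l ?invr_ge0 //; apply: ler_sum => J _.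
rewrite ler_nat; have [_|nQ] := boolP (Q J); first exact: leq_b1.
by rewrite ltNge (hausdorff_subsample_le (hQ _ nQ) hr).
Qed.

Lemma critical_value_le b alpha (r : R) :
  0 <= r -> subsampling_tail f m tau b ts r <= alpha ->
  critical_value f m tau b alpha ts <= 2 * r.
Proof.
move=> r0 hr; rewrite ler_wpM2l //; apply: ge_inf => //.
by exists 0 => x [].
Qed.

(** Below half of this level every subsample is far, so the tail is 1 and exceeds [alpha]. *)
Lemma critical_value_ge b alpha h (r : R) :
  spread [set: 'I_n] h -> (0 < b <= n)%N -> alpha < 1 ->
  0 <= r -> subsampling_tail f m tau b ts r <= alpha ->
  (f v - f u) / b%:R - 2 * (Lam * h) <= critical_value f m tau b alpha ts.
Proof.
move=> sp /andP[b0 bn] a1 r0 hr.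
have -> : (f v - f u) / b%:R - 2 * (Lam * h) =
  2 * ((f v - f u) / (2 * b%:R) - Lam * h).
  by field; rewrite pnatr_eq0 -lt0n.
(* The level [r] makes the set nonempty; the [inf] of the empty set would be 0. *)
rewrite ler_wpM2l //; apply: lb_le_inf; first by exists r.
move=> s [s0 hs]; rewrite leNgt; apply/negP => slt; move: hs; apply/negP.
rewrite -ltNge /subsampling_tail; apply: lt_le_trans a1 _.
rewrite (eq_bigr (fun=> 1)) => [|J /eqP Jb]; last first.
  by rewrite (lt_le_trans slt) // (hausdorff_subsample_ge sp Jb).
rewrite sumr_const -cardsE card_draws card_ord mulVf //.
by rewrite pnatr_eq0 -lt0n bin_gt0.
Qed.

End Sample.

(** The tail at [d / 8] gives [4 * c <= d], and [hh] makes [c] at least three quarters of the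
    increment over [b], hence larger than [Lam * h]: stability applies with [eta = Lam * h]. *)
Lemma test_rejects (F : fieldType) (n b : nat) (ts : 'I_n -> R) (u v d h alpha C : R) :
  (forall i, Tmin <= ts i <= Tmax) ->
  Tmin <= u <= Tmax -> Tmin <= v <= Tmax -> f u < f v ->
  spread ts [set: 'I_n] h -> (0 < b <= n)%N -> alpha < 1 ->
  8 * (Lam * h) <= (f v - f u) / b%:R -> 0 <= d ->
  subsampling_tail f m tau b ts (d / 8) <= alpha ->
  dgm F (SW_curve f m tau Tmin Tmax) (0, C) -> d <= C ->
  phi f m tau F b alpha ts = 1%N.
Proof.
move=> ts_in hu hv fuv sp hb a1 hh d0 tail hC dC.
have [b0 bn] := andP hb.
have d8 : 0 <= d / 8 by rewrite divr_ge0.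
have c1 := critical_value_le d8 tail.
have c2 := critical_value_ge ts_in hu hv fuv sp hb a1 d8 tail.
set c := critical_value _ _ _ _ _ _ in c1 c2.
have h0 : 0 <= Lam * h.
  rewrite mulr_ge0 ?Lam_ge0 //.
  by have [|i _ hi] := sp Tmin; [rewrite lexx ltW|apply: le_trans hi].
have l0 : 0 < (f v - f u) / b%:R by rewrite divr_gt0 ?subr_gt0 ?ltr0n.
have [||||||z [z1 z2 z3]] := dgm_stable (A' := SW_sample f (m := m) tau ts)
  (eta := Lam * h) (c := c) _ _ SW_curve_bounded _ _ _ _ hC.
- have i : 'I_n by exact: Ordinal (leq_trans b0 bn).
  by exists (SW f m tau (ts i)); exists i.
- exact: sample_in_curve.
- by move=> _ [s hs <-]; apply: sample_near => //; move: hs; rewrite /= in_itv.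
- exact: h0.
- by move: hh c2 l0 h0; set x := _ / _; lra.
- by move: c1 dC; lra.
suff : `[< dgm F (SW_sample f (m := m) tau ts) `&`
  rejection_region f m tau F b alpha ts !=set0 >] = true by rewrite /phi => ->.
by apply/asboolP; exists z; split=> //; split.
Qed.

End Signal.

(** * Covering probabilities *)

Section Grid.
Variables (R : realType) (a w : R) (k : nat).
Hypotheses (w0 : 0 <= w) (k0 : (0 < k)%N).

Definition cell (c : nat) : set R :=
  `[a + c%:R * (w / k%:R), a + c.+1%:R * (w / k%:R)].

(** The least [c] whose cell ends at or after [s] serves. *)
Lemma mem_cell s : a <= s <= a + w -> exists2 c, (c < k)%N & cell c s.
Proof.
move=> /andP[sa sw]; pose h := w / k%:R.
have kr : 0 < k%:R :> R by rewrite ltr0n.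
have hk : k%:R * h = w by rewrite mulrC divfK // gt_eqF.
have h0 : 0 <= h by rewrite divr_ge0.
have : exists n, s <= a + n.+1%:R * h.
  by exists k.-1; rewrite prednK // hk.
case/ex_minnP => c hc cmin.
exists c.
  by rewrite -[k]prednK // ltnS; apply: cmin; rewrite prednK // hk.
rewrite /cell /= in_itv /= hc andbT.
case: c hc cmin => [|c] hc cmin; first by rewrite mul0r addr0.
rewrite leNgt; apply/negP => /ltW /cmin; by rewrite ltnn.
Qed.

Lemma cell_diameter c s s' : cell c s -> cell c s' -> `|s - s'| <= w / k%:R.
Proof.
rewrite /cell /= !in_itv /= -natr1 mulrDl mul1r; set h := w / _.
by move=> /andP[h1 h2] /andP[h3 h4]; rewrite ler_norml; apply/andP; split; lra.
Qed.

End Grid.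

Section CoveringProbability.
Context (d : measure_display) (Omega : measurableType d) (R : realType).
Variables (P : probability Omega R) (Tmin Tmax : R) (hT : Tmin < Tmax).
Variables (t : nat -> {RV P >-> R}) (ht : iid_uniform hT t).

Let w : R := Tmax - Tmin.
Let w0 : 0 < w. Proof. by rewrite subr_gt0. Qed.

Lemma measurable_itvC (p q : R) : measurable (~` `[p, q]).
Proof. by apply: measurableC; exact: measurable_itv. Qed.

Lemma measurable_preimage_itvC i (p q : R) :
  measurable (t i @^-1` (~` `[p, q])).
Proof.
rewrite -[X in measurable X]setTI; apply: measurable_funP => //.
exact: measurable_itvC.
Qed.

Lemma uniform_prob_itv (p q : R) : Tmin <= p -> p <= q -> q <= Tmax ->
  uniform_prob hT `[p, q] = ((q - p) / w)%:E.
Proof.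
move=> hp pq hq; rewrite /uniform_prob.
rewrite (eq_integral (fun=> w^-1%:E)); last first.
  move=> x; rewrite inE /= in_itv /= => /andP[h1 h2].
  by rewrite /uniform_pdf (le_trans hp h1) (le_trans h2 hq).
rewrite integral_cst //= lebesgue_measure_itv /= lte_fin.
case: ltgtP pq => // [pq|->] _; last by rewrite subrr mul0r mule0.
by rewrite -EFinB -EFinM mulrC.
Qed.

Lemma prob_outside i : P (t i @^-1` (~` `[Tmin, Tmax])) = 0%E.
Proof.
have [_ hu] := ht; have := hu i (~` `[Tmin, Tmax]).
rewrite /distribution /= /pushforward => ->; last exact: measurable_itvC.
rewrite probability_setC //= uniform_prob_itv ?lexx ?ltW //.
by rewrite divff ?gt_eqF // -EFinB subrr.
Qed.

Let cellT := cell Tmin w.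

Lemma prob_not_cell k c i : (c < k)%N ->
  P (t i @^-1` (~` cellT k c)) = (1 - k%:R^-1)%:E.
Proof.
move=> ck; have k0 : (0 < k)%N by apply: leq_ltn_trans ck.
have kr : 0 < k%:R :> R by rewrite ltr0n.
have wk : 0 <= w / k%:R by rewrite divr_ge0 // ltW.
have [_ hu] := ht; have := hu i (~` cellT k c).
rewrite /distribution /= /pushforward => ->; last exact: measurable_itvC.
rewrite probability_setC; last exact: measurable_itv.
rewrite /= /cellT /cell uniform_prob_itv; last 3 first.
- by rewrite lerDl mulr_ge0.
- by rewrite lerD2l ler_wpM2r // ler_nat.
- rewrite -lerBrDl -/w mulrCA ger_pMr // ler_pdivrMr // mul1r ler_nat //.
rewrite -EFinB; congr (1 - _)%:E.
by rewrite -natr1; field; rewrite !gt_eqF.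
Qed.

Definition misses (I : seq nat) (k : nat) : set Omega :=
  \big[setU/set0]_(c < k)
    \big[setI/setT]_(i <- I) (t i @^-1` (~` cellT k c)).

Lemma measurable_misses I k : measurable (misses I k).
Proof.
apply: bigsetU_measurable => c _; apply: bigsetI_measurable => i _.
exact: measurable_preimage_itvC.
Qed.

(** Union bound over [k] equally likely cells, each missed by [b] independent times. *)
Definition miss_bound (k b : nat) : R := k%:R * (1 - k%:R^-1) ^+ b.

Lemma miss_bound_ge0 k b : 0 <= miss_bound k b.
Proof.
rewrite /miss_bound mulr_ge0 // exprn_ge0 // subr_ge0.
by case: k => [|k]; rewrite ?invr0 // invf_le1 ?ltr0n // ler1n.
Qed.

Lemma prob_misses I k : uniq I -> (P (misses I k) <= (miss_bound k (size I))%:E)%E.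
Proof.
move=> uI.
pose E c := \big[setI/setT]_(i <- I) (t i @^-1` (~` cellT k c)).
apply: le_trans (Boole_inequality (A := E) P (n := k) _) _.
  move=> c _; apply: bigsetI_measurable => i _.
  exact: measurable_preimage_itvC.
rewrite (eq_bigr (fun=> ((1 - k%:R^-1) ^+ size I)%:E)) => [|c _].
  by rewrite sumEFin sumr_const card_ord /miss_bound mulr_natl.
have [hind _] := ht; have mc (i : nat) : measurable (~` cellT k c).
  exact: measurable_itvC.
rewrite [LHS](hind I (fun=> ~` cellT k c) uI mc).
rewrite (eq_bigr (fun=> (1 - k%:R^-1)%:E)) => [|i _]; last exact: prob_not_cell.
by rewrite prodEFin big_const_seq count_predT iter_mulr_1.
Qed.

Lemma not_misses I k omega : ~ misses I k omega ->
  forall c, (c < k)%N -> exists2 i, i \in I & cellT k c (t i omega).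
Proof.
move=> h c ck; apply: contrapT => no; apply: h.
rewrite /misses -(bigcup_mkord k (fun c =>
  \big[setI/setT]_(i <- I) (t i @^-1` (~` cellT k c)))); exists c => //=.
rewrite -bigcap_seq => i /= iI hc; by apply: no; exists i.
Qed.

(** * Averages over subsamples *)

Section Average.
Variables (n b k : nat).
Hypothesis bn : (b <= n)%N.

Definition index_seq (J : {set 'I_n}) : seq nat := [seq val j | j <- enum J].

Lemma index_seq_uniq J : uniq (index_seq J).
Proof. by rewrite map_inj_uniq ?enum_uniq //; exact: val_inj. Qed.

Lemma size_index_seq J : size (index_seq J) = #|J|.
Proof. by rewrite size_map -cardE. Qed.

Lemma not_misses_spread (J : {set 'I_n}) omega : (0 < k)%N ->
  ~ misses (index_seq J) k omega ->
  spread Tmin Tmax (fun i : 'I_n => t i omega) J (w / k%:R).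
Proof.
move=> k0 /not_misses hm s hs.
have [||c ck cs] := @mem_cell R Tmin w k _ k0 s.
- by rewrite subr_ge0 ltW.
- by rewrite /w subrKC.
have [_ /mapP[i iJ ->] hi] := hm c ck; exists i; first by rewrite -mem_enum.
exact: cell_diameter hi cs.
Qed.

(** For times in the interval and fine enough cells it dominates [subsampling_tail], and as a finite
    combination of indicators it is measurable. *)
Definition miss_average (omega : Omega) : R :=
  'C(n, b)%:R^-1 *
  \sum_(J : {set 'I_n} | #|J| == b) \1_(misses (index_seq J) k) omega.

Lemma measurable_miss_average : measurable_fun setT miss_average.
Proof.
rewrite /miss_average; under eq_fun do rewrite -big_filter.
apply: measurable_funM => //.
by apply: measurable_sum => J; apply: measurable_indic; exact: measurable_misses.
Qed.

(** Markov's inequality; the expectation is an average of probabilities, each at most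
    [miss_bound k b]. *)
Lemma prob_miss_average (alpha : R) : 0 < alpha ->
  (P [set omega | (alpha <= miss_average omega)%R]
    <= (alpha^-1 * miss_bound k b)%:E)%E.
Proof.
move=> a0.
have C0 : 0 < 'C(n, b)%:R :> R by rewrite ltr0n bin_gt0.
have ge0 omega : 0 <= miss_average omega.
  by rewrite mulr_ge0 ?invr_ge0 // sumr_ge0 // => J _; rewrite indicE.
have mf : measurable_fun [set: Omega] (EFin \o miss_average).
  exact/measurable_EFinP/measurable_miss_average.
have := le_integral_abse P measurableT mf a0; rewrite setTI.
have -> : [set x | (alpha%:E <= `|(EFin \o miss_average) x|)%E] =
          [set omega | alpha <= miss_average omega].
  by apply/seteqP; split=> x /=; rewrite lee_fin ger0_norm.
have -> : (\int[P]_x `|(EFin \o miss_average) x|)%E = (\int[P]_x (miss_average x)%:E)%E.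
  by apply: eq_integral => x _ /=; rewrite ger0_norm.
move=> h.
suff hint : (\int[P]_x (miss_average x)%:E <= (miss_bound k b)%:E)%E.
  rewrite EFinM lee_pdivlMl //; exact: le_trans h hint.
rewrite /miss_average.
under eq_integral do rewrite EFinM -sumEFin.
have mI (J : {set 'I_n}) : measurable_fun [set: Omega]
    (EFin \o (\1_(misses (index_seq J) k) : Omega -> R)).
  by apply/measurable_EFinP/measurable_indic/measurable_misses.
rewrite ge0_integralZl //; last 2 first.
- under eq_fun do rewrite -big_filter.
  by apply: emeasurable_sum => J; exact: mI.
- by move=> x _; apply: sume_ge0 => J _; rewrite lee_fin.
under eq_integral do rewrite -big_filter.
rewrite ge0_integral_sum //= big_filter.
rewrite lee_pdivrMl //.
apply: (@le_trans _ _ (\sum_(J : {set 'I_n} | #|J| == b) (miss_bound k b)%:E)%E).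
  apply: lee_sum => J /eqP Jb.
  rewrite integral_indic ?setIT //; last exact: measurable_misses.
  by rewrite -Jb -size_index_seq; apply/prob_misses/index_seq_uniq.
rewrite sumEFin sumr_const -cardsE card_draws card_ord -EFinM lee_fin.
by rewrite mulr_natl.
Qed.

End Average.

Lemma measurable_miss_average_ge n b k alpha :
  measurable [set omega | alpha <= miss_average n b k omega].
Proof.
have := measurable_miss_average n b k measurableT (measurable_itv `[alpha, +oo[).
rewrite setTI; congr measurable; apply/seteqP; split=> x /=;
  by rewrite in_itv /= andbT.
Qed.

(** A measurable event that will contain acceptance: a time outside the interval (of probability 0),
    a cell of the fine grid [k] missed by the whole sample, or too many subsamples missing a cell of
    the coarse grid [k0]. *)
Definition bad_event (n b k k0 : nat) (alpha : R) : set Omega :=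
  (\big[setU/set0]_(i < n) (t i @^-1` (~` `[Tmin, Tmax])) `|`
   misses (index_seq [set: 'I_n]) k) `|`
  [set omega | alpha <= miss_average n b k0 omega].

Lemma bad_event_measurable n b k k0 alpha : measurable (bad_event n b k k0 alpha).
Proof.
apply: measurableU; last exact: measurable_miss_average_ge.
apply: measurableU; last exact: measurable_misses.
by apply: bigsetU_measurable => i _; exact: measurable_preimage_itvC.
Qed.

Lemma prob_bad_event n b k k0 alpha : (b <= n)%N -> 0 < alpha ->
  (P (bad_event n b k k0 alpha) <=
    (miss_bound k n + alpha^-1 * miss_bound k0 b)%:E)%E.
Proof.
move=> bn a0; rewrite EFinD.
have m1 : measurable (\big[setU/set0]_(i < n) (t i @^-1` (~` `[Tmin, Tmax]))).
  by apply: bigsetU_measurable => i _; exact: measurable_preimage_itvC.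
apply: le_trans (measureU2 P (measurableU _ _ m1 (measurable_misses _ _))
  (measurable_miss_average_ge _ _ _ _)) _.
apply: leeD; last exact: prob_miss_average.
apply: le_trans (measureU2 P m1 (measurable_misses _ _)) _.
rewrite -[leRHS]add0e; apply: leeD.
  apply: le_trans (Boole_inequality P (n := n)
    (A := fun i => t i @^-1` (~` `[Tmin, Tmax])) _) _.
    by move=> i _; exact: measurable_preimage_itvC.
  by rewrite big1 // => i _; exact: prob_outside.
have := @prob_misses (index_seq [set: 'I_n]) k (index_seq_uniq _).
by rewrite size_index_seq cardsT card_ord.
Qed.

End CoveringProbability.

(** * Asymptotics *)

Section Limits.
Variable R : realType.

Lemma miss_bound_fixed_cvg0 (k : nat) (b : nat -> nat) : (0 < k)%N ->
  b n @[n --> \oo] --> \oo ->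
  (miss_bound R k (b n) : R) @[n --> \oo] --> (0 : R).
Proof.
move=> k0 hb; have kr : 0 < k%:R :> R by rewrite ltr0n.
rewrite -(mulr0 k%:R); apply: cvgM; first exact: cvg_cst.
apply: (@cvg_comp _ _ _ b (fun n => (1 - k%:R^-1) ^+ n : R) _ _ _ hb).
apply: cvg_expr; rewrite ger0_norm ?subr_ge0 ?invf_le1 ?ler1n //.
by rewrite ltrBlDr ltrDl invr_gt0.
Qed.

Lemma ln_nat_ge1 : \forall n \near \oo, 1 <= ln (n%:R : R).
Proof.
near=> n.
have h : expR 1 <= n%:R :> R.
  apply: (@le_trans _ _ (Num.truncn (expR 1 : R)).+1%:R).
    exact/ltW/truncnS_gt.
  by rewrite ler_nat; near: n; exact: nbhs_infty_ge.
by rewrite -[leLHS](expRK 1) ler_ln ?posrE ?expR_gt0 // (lt_le_trans (expR_gt0 1)).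
Unshelve. all: by end_near.
Qed.

Lemma subsample_size_small (b : nat -> nat) (D : nat) : (0 < D)%N ->
  ((fun n => (b n)%:R : R^o) =o_\oo (fun n => n%:R / ln n%:R : R^o)) ->
  \forall n \near \oo, (b n)%:R * (2 * D%:R * ln n%:R) <= n%:R :> R.
Proof.
move=> D0 /eqoP hbn; have Dr : 0 < D%:R :> R by rewrite ltr0n.
have e0 : 0 < (2 * D%:R)^-1 :> R by rewrite invr_gt0 mulr_gt0.
have {}hbn := hbn _ e0; near=> n.
have hl : 1 <= ln (n%:R : R) by near: n; exact: ln_nat_ge1.
have l0 : 0 < ln (n%:R : R) by apply: lt_le_trans hl.
have : `|(b n)%:R : R^o| <= (2 * D%:R)^-1 * `|n%:R / ln n%:R : R^o| by near: n.
rewrite !ger0_norm //; last by rewrite divr_ge0 // ltW.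
rewrite ler_pdivlMl ?mulr_gt0 // ler_pdivlMr //; congr (_ <= _); ring.
Unshelve. all: by end_near.
Qed.

(** With k = D b, eventually at most n / (2 ln n), one has (1 - 1/k)^n <= exp(-n/k) <= n^-2; as b <=
    n, the bound k n^-2 is at most D / n. *)
Lemma miss_bound_grid_cvg0 (b : nat -> nat) (D : nat) : (0 < D)%N ->
  b n @[n --> \oo] --> \oo ->
  ((fun n => (b n)%:R : R^o) =o_\oo (fun n => n%:R / ln n%:R : R^o)) ->
  (miss_bound R (D * b n) n : R) @[n --> \oo] --> (0 : R).
Proof.
move=> D0 hb hbn; have Dr : 0 < D%:R :> R by rewrite ltr0n.
apply: (@squeeze_cvgr _ _ _ _ (fun=> 0) (fun n => 2 * D%:R * harmonic n)).
- near=> n; rewrite miss_bound_ge0 /=.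
  have n0 : (0 < n)%N by near: n; exact: nbhs_infty_gt.
  have b0 : (0 < b n)%N by near: n; move/cvgnyPgt : hb; exact.
  have hl : 1 <= ln (n%:R : R) by near: n; exact: ln_nat_ge1.
  have hs : (b n)%:R * (2 * D%:R * ln n%:R) <= n%:R :> R.
    by near: n; exact: subsample_size_small.
  have nr : 0 < n%:R :> R by rewrite ltr0n.
  have br : 0 < (b n)%:R :> R by rewrite ltr0n.
  have D1 : 1 <= D%:R :> R by rewrite ler1n.
  have bn : (b n)%:R <= n%:R :> R.
    by apply: le_trans hs; rewrite ler_peMr //; nra.
  have kr : 0 < (D * b n)%:R :> R by rewrite ltr0n muln_gt0 D0.
  have h1 : (1 - (D * b n)%:R^-1) ^+ n <= (n%:R^-1) ^+ 2 :> R.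
    have hle : (1 - (D * b n)%:R^-1) ^+ n <= expR (- (D * b n)%:R^-1) ^+ n :> R.
      apply: lerXn2r; rewrite ?nnegrE ?expR_ge0 ?expR_ge1Dx //.
      by rewrite subr_ge0 invf_le1 // ler1n muln_gt0 D0.
    apply: (le_trans hle); rewrite -expRM_natr.
    rewrite -[X in _ <= X ^+ 2](@lnK R) ?posrE ?invr_gt0 // lnV ?posrE //.
    rewrite -expRM_natr ler_expR !mulNr lerN2 [leRHS]mulrC ler_pdivlMr //.
    by move: hs; rewrite natrM; nra.
  rewrite /miss_bound; apply: (@le_trans _ _ ((D * b n)%:R * (n%:R^-1) ^+ 2)).
    by rewrite ler_wpM2l.
  apply: (@le_trans _ _ (D%:R * n%:R^-1)).
    rewrite natrM expr2 mulrACA -[leRHS]mulr1 ler_wpM2l //.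
    by rewrite ler_pdivrMr // mul1r.
  (* [harmonic n] is 1 / (n + 1), whence the factor 2. *)
  rewrite /harmonic /= -mulrA [2 * _]mulrC -mulrA ler_wpM2l //.
  rewrite mulrC -(@invrK _ 2) -invfM lef_pV2 ?posrE ?mulr_gt0 ?invr_gt0 //.
  by rewrite mulrC ler_pdivrMr // -natrM ler_nat; lia.
- exact: cvg_cst.
rewrite -[X in _ --> X](mulr0 (2 * D%:R)); apply: cvgM; first exact: cvg_cst.
exact: cvg_harmonic.
Unshelve. all: by end_near.
Qed.

End Limits.

(** Outside the bad event the sample is spread at the fine scale and the tail at [a / 8] is below
    [alpha], so [test_rejects] applies. *)
Lemma bad_event_accepts (R : realType) (F : fieldType)
    (d : measure_display) (Omega : measurableType d) (P : probability Omega R)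
    (Tmin Tmax : R) (hT : Tmin < Tmax) (t : nat -> {RV P >-> R})
    (delta L K eps : R) (f : R -> R) (m : nat) (tau alpha u v a D : R)
    (n b k k0 : nat) (omega : Omega) :
  0 < delta -> regular delta L K eps f ->
  Tmin <= u <= Tmax -> Tmin <= v <= Tmax -> f u < f v ->
  (0 < b <= n)%N -> (0 < k)%N -> (0 < k0)%N -> alpha < 1 -> 0 <= a ->
  8 * (m.+1%:R * L * ((Tmax - Tmin) / k%:R)) <= (f v - f u) / b%:R ->
  m.+1%:R * L * ((Tmax - Tmin) / k0%:R) <= a / 8 ->
  dgm F (SW_curve f m tau Tmin Tmax) (0, D) -> a <= D ->
  phi f m tau F b alpha (fun i : 'I_n => t i omega) = 0%N ->
  bad_event Tmin Tmax t n b k k0 alpha omega.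
Proof.
move=> delta0 freg hu hv fuv hb k_gt0 k0_gt0 a1 a0 hk hk0 hD aD; apply: contraPP.
move=> /not_orP[/not_orP[ho hm]] /negP; rewrite -ltNge => ha.
have ts_in i : Tmin <= t (i : 'I_n) omega <= Tmax.
  apply/negPn/negP => hi; apply: ho.
  rewrite -(bigcup_mkord n (fun i => t i @^-1` (~` `[Tmin, Tmax]))).
  by exists i => //=; rewrite in_itv /=; apply/negP.
have sp := not_misses_spread hT k_gt0 hm.
rewrite (test_rejects freg hT ts_in hu hv fuv sp hb a1 hk a0 _ hD aD) //.
apply: le_trans (ltW ha); rewrite /miss_average.
pose Q (J : {set 'I_n}) := `[< misses Tmin Tmax t (index_seq J) k0 omega >].
apply: le_trans (subsampling_tail_le tau freg hT ts_in b (Q := Q) hk0 _) _.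
  by move=> J /asboolPn; apply: not_misses_spread.
by rewrite ler_wpM2l ?invr_ge0.
Qed.

(* [mu_ext P] is the outer measure of [P]: it equals [P] on measurable events,
   and gives a meaning to the error probability without presupposing that the
   acceptance event, defined through persistent homology, is measurable. *)
Theorem theorem6p2 (R : realType) (F : fieldType)
    (d : measure_display) (Omega : measurableType d) (P : probability Omega R)
    (Tmin Tmax : R) (hT : Tmin < Tmax)
    (t : nat -> {RV P >-> R}) (ht : iid_uniform hT t)
    (m : nat) (tau delta L C : R) (tau0 : R -> R -> (R -> R) -> R)
    (hdelta : 0 < delta)
    (hC : feature_constant F m tau Tmin Tmax tau0 delta L C)
    (K eps Xi : R) (hK : 0 < K) (heps : 0 < eps) (hXi : 0 < Xi)
    (f : R -> R) (hreg : regular delta L K eps f)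
    (hH1 : eps_periodic Xi eps K f)
    (htau : 0 < tau < tau0 K eps f)
    (alpha : R) (halpha : 0 < alpha < 1)
    (b : nat -> nat)
    (hb : b n @[n --> \oo] --> \oo)
    (hbn : (fun n => (b n)%:R : R^o) =o_\oo (fun n => n%:R / ln n%:R : R^o))
    (hc : {ae P, forall w, \forall n \near \oo,
       4 * critical_value f m tau (b n) alpha (fun i : 'I_n => t i w) <=
         feature_size m eps C}) :
  (limn_esup (fun n => mu_ext P
     [set w | phi f m tau F (b n) alpha (fun i : 'I_n => t i w) = 0%N])
   <= alpha%:E)%E.
Proof.
have [alpha0 alpha1] := andP halpha.
have [C0 hfeat] := hC.
have [D aD hdgm] := hfeat _ _ _ _ hK heps hXi hreg hH1 htau.
set a := feature_size m eps C in aD hdgm.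
have a0 : 0 < a.
  by rewrite mulr_gt0 ?divr_gt0 ?sqrtr_gt0 // lt_min heps.
have hD : dgm F (SW_curve f m tau Tmin Tmax) (0, D).
  have : [set (0, D)] ((0 : R), D) by [].
  by rewrite -[X in X _]hdgm => -[].
have [u [v [hu hv fuv]]] := regular_nonconstant hdelta hreg hT.
pose mesh : R := m.+1%:R * L * (Tmax - Tmin).
have mesh0 : 0 <= mesh.
  by rewrite mulr_ge0 ?subr_ge0 ?(Lam_ge0 _ hreg) // ltW.
have grid (x : R) : 0 < x -> exists2 k : nat, (0 < k)%N & mesh / k%:R <= x.
  move=> x0; exists (Num.truncn (mesh / x)).+1 => //.
  by rewrite ler_pdivrMr // mulrC -ler_pdivrMr // ltW // truncnS_gt.
(* The coarse grid is fixed: its cells have images of diameter at most [a / 8], the level at which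
   the tail is tested. *)
have [k0 k0_gt0 hk0] : exists2 k : nat, (0 < k)%N & mesh / k%:R <= a / 8.
  by apply: grid; rewrite divr_gt0.
(* With [G * b n] cells the images have diameter at most the increment of [f] over [8 * b n], the
   ratio required for rejection. *)
have [G G_gt0 hG] : exists2 k : nat, (0 < k)%N & mesh / k%:R <= (f v - f u) / 8.
  by apply: grid; rewrite divr_gt0 // subr_gt0.
pose bound n : R := miss_bound R (G * b n) n + alpha^-1 * miss_bound R k0 (b n).
have bound0 : bound n @[n --> \oo] --> (0 : R).
  rewrite -[X in _ --> X](addr0 0) -[X in _ --> _ + X](mulr0 alpha^-1).
  apply: cvgD; first exact: miss_bound_grid_cvg0.
  by apply: cvgM; [exact: cvg_cst|exact: miss_bound_fixed_cvg0].
set err := fun n => mu_ext P _.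
have err0 : err n @[n --> \oo] --> 0%E.
  apply: (@squeeze_cvge _ _ _ _ (fun=> 0%E) _ (fun n => (bound n)%:E)).
  - near=> n; rewrite mu_ext_ge0 //=.
    have b0 : (0 < b n)%N by near: n; move/cvgnyPgt : hb; exact.
    have hl : 1 <= ln (n%:R : R) by near: n; exact: ln_nat_ge1.
    have bn : (b n <= n)%N.
      (* The growth condition with [D = 1] also gives [b n <= n] eventually. *)
      have : (b n)%:R * (2 * 1%:R * ln n%:R) <= n%:R :> R.
        by near: n; exact: subsample_size_small.
      by rewrite -(ler_nat R); apply: le_trans; rewrite ler_peMr //; lra.
    apply: le_trans (prob_bad_event ht (G * b n) k0 bn alpha0).
    rewrite -(measurable_mu_extE P); last exact: bad_event_measurable.
    apply: le_mu_ext => w /=; apply: (@bad_event_accepts R F _ _ P _ _ hT t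
      delta L K eps f m tau alpha u v a D) => //.
    + by rewrite b0.
    + by rewrite muln_gt0 G_gt0.
    + exact: ltW.
    + rewrite natrM invfM (_ : 8 * _ = 8 * (mesh / G%:R) / (b n)%:R).
        by rewrite ler_wpM2r ?invr_ge0 // mulrC -ler_pdivlMr.
      by rewrite /mesh !mulrA.
    + by rewrite mulrA.
  - exact: cvg_cst.
  - by apply: cvg_EFin; [exact: nearW|exact: bound0].
by rewrite (cvg_limn_einf_sup err0).2 lee_fin ltW.
Unshelve. all: by end_near.
Qed.
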